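(* Let $\mathbb L=(\emptyset,\mathbb R)$ be a $\lambda$-ary relational language (no function symbols). Then every $\lambda$-presentable $\mathbb L$-structure $A$ has a presentation formula in $\mathbb L_{\lambda\lambda}$.
   Context: **Base.** $\lambda$ is a regular cardinal and $\mathcal V=(\mathcal V_0,\otimes,I)$ is a symmetric monoidal closed category which is locally $\lambda$-presentable as a closed category: $\mathcal V_0$ is locally $\lambda$-presentable and the full subcategory $\mathcal V_\lambda$ of $\lambda$-presentable objects contains $I$ and is closed under $\otimes$. The internal hom is written $A^X:=[X,A]$. $\mathcal V^\to$ is the $\mathcal V$-category of arrows of $\mathcal V$. An enriched factorization system $(\mathcal E,\mathcal M)$ on $\mathcal V$ is an orthogonal factorization system on $\mathcal V_0$ with $\mathcal E$ closed under copowers in $\mathcal V^\to$ (equivalently $\mathcal M$ closed under powers in $\mathcal V^\to$). We fix one that is proper (every map in $\mathcal E$ is an epimorphism, every map in $\mathcal M$ a monomorphism) and such that $\mathcal M$ is closed in $\mathcal V^\to$ under $\lambda$-filtered colimits. **Relational languages and structures.** A relational language is a set $\mathbb R$ of relation symbols $R:X$ with arity $X\in\mathcal V$; it is $\lambda$-ary if all arities lie in $\mathcal V_\lambda$. An $\mathbb L$-structure is an object $A\in\mathcal V$ with a map $r_A\colon R_A\rightarrowtail A^X$ in $\mathcal M$ for each $R:X$. A morphism $h\colon A\to B$ of structures is a map in $\mathcal V$ such that for every $R:X$ there is $h_R\colon R_A\to R_B$ with $r_Bh_R=h^Xr_A$. $\mathrm{Str}(\mathbb L)$ is the $\mathcal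 V$-category of $\mathbb L$-structures whose hom-object from $A$ to $B$ is the limit obtained from $[A,B]$ by pulling back, for each $R:X$, the map $[A,B]\to[R_A,B^X]$ ($h\mapsto h^Xr_A$) along $[R_A,r_B]\colon[R_A,R_B]\to[R_A,B^X]$. A $\lambda$-presentable $\mathbb L$-structure is a $\lambda$-presentable object of $\mathrm{Str}(\mathbb L)$. **Formulas.** Since there are no function symbols, an $(X,Y)$-ary (extended) term is a morphism $t\colon Y\to X$ in $\mathcal V$, interpreted on $A$ as $t_A=A^t\colon A^X\to A^Y$. Atomic formulas: $s(x)=t(x)$, of arity $X$, for $(X,Y)$-ary terms $s,t$; and $R^Y(t(z))$, of arity $Z$, for $R:X$, an arity $Y$, and a $(Z,X\otimes Y)$-ary term $t$. Formulas are built from these by conjunctions $\bigwedge_{j\in J}\varphi_j(x)$ of formulas of the same arity and existential quantification $(\exists y)\psi(x,y)$, of arity $X$, for $\psi$ of arity $X+Y$. $\mathbb L_{\lambda\lambda}$-formulas are those where $\mathbb L$ is $\lambda$-ary, all arities are $\lambda$-presentable and all conjunctions have size $<\lambda$. The interpretation $\varphi_A\rightarrowtail A^X$ (a map in $\mathcal M$) is: for $s=t$, the $\mathcal M$-part of the $(\mathcal E,\mathcal M)$-factorization of the equalizer of $s_A,t_A$; for $R^Y(t)$, the pullback of $r_A^Y\colon R_A^Y\to (A^{X})^Y\cong A^{X\otimes Y}$ along $t_A$; for conjunctions, the intersection; for $(\exists y)\psi$, the $\mathcal M$-part of the $(\mathcal E,\mathcal M)$-factorization of $\psi_A\rightarrowtail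 A^{X+Y}\cong A^X\times A^Y\to A^X$. For $a\colon X\to A$ in $\mathcal V$, $A\models\varphi[a]$ means that the transpose $I\to A^X$ of $a$ factors through $\varphi_A\rightarrowtail A^X$. **Presentation formulas.** For a $\lambda$-presentable $\mathbb L$-structure $A$, an $X$-ary formula $\pi^A(x)$ of $\mathbb L_{\lambda\lambda}$ is a presentation formula of $A$ if for every $\mathbb L$-structure $B$ there is a bijection, natural in $B$, between the elements $a\colon X\to B$ with $B\models\pi^A[a]$ and the morphisms $\bar a\colon A\to B$ of $\mathbb L$-structures. *)

(* Defs.v *)
From Corelib Require Import ssreflect ssrfun.
From Stdlib Require Import ClassicalEpsilon ProofIrrelevance FunctionalExtensionality.

Set Implicit Arguments.
Unset Strict Implicit.
Unset Printing Implicit Defensive.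

Declare Scope cat_scope.
Delimit Scope cat_scope with cat.
Local Open Scope cat_scope.
#[local] Obligation Tactic := idtac.

(* The universe of small sets.  Hom-sets are small; objects need not be. *)
Definition U := Type.

Definition card_le (S T : U) : Prop := exists f : S -> T, injective f.
Definition card_lt (S T : U) : Prop := card_le S T /\ ~ card_le T S.

Record regular_cardinal := RegularCardinal {
  card :> U;
  card_infinite : card_le nat card;
  card_regular : forall (J : U) (T : J -> U),
    card_lt J card -> (forall j, card_lt (T j) card) ->
    card_lt {j : J & T j} card }.

Record category_laws (O : Type) (H : O -> O -> U) := CategoryLaws {
  idm_ : forall X, H X X;
  mcomp_ : forall X Y Z, H Y Z -> H X Y -> H X Z;
  mcomp1m_ : forall X Y (f : H X Y), mcomp_ (idm_ Y) f = f;
  mcompm1_ : forall X Y (f : H X Y), mcomp_ f (idm_ X) = f;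
  mcompA_ : forall X Y Z W (h : H Z W) (g : H Y Z) (f : H X Y),
    mcomp_ h (mcomp_ g f) = mcomp_ (mcomp_ h g) f }.

Record category := Category {
  ob :> Type;
  hom : ob -> ob -> U;
  cat_laws : category_laws hom }.

Record small_category := SmallCategory {
  sob : U;
  shom : sob -> sob -> U;
  scat_laws : category_laws shom }.

Definition category_of_small (J : small_category) : category :=
  Category (scat_laws J).
Coercion category_of_small : small_category >-> category.

Definition idm (C : category) (X : C) : hom X X := idm_ (cat_laws C) X.
Definition mcomp (C : category) (X Y Z : C) (g : hom Y Z) (f : hom X Y) :
  hom X Z := mcomp_ (cat_laws C) g f.
Notation "g ∘ f" := (mcomp g f) (at level 40, left associativity) : cat_scope.

Section CategoryLemmas.
Variable C : category.
Lemma mcomp1m (X Y : C) (f : hom X Y) : idm Y ∘ f = f.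
Proof. exact: mcomp1m_. Qed.
Lemma mcompm1 (X Y : C) (f : hom X Y) : f ∘ idm X = f.
Proof. exact: mcompm1_. Qed.
Lemma mcompA (X Y Z W : C) (h : hom Z W) (g : hom Y Z) (f : hom X Y) :
  h ∘ (g ∘ f) = h ∘ g ∘ f.
Proof. exact: mcompA_. Qed.
End CategoryLemmas.

Definition mono (C : category) (X Y : C) (m : hom X Y) : Prop :=
  forall W (f g : hom W X), m ∘ f = m ∘ g -> f = g.
Definition epi (C : category) (X Y : C) (e : hom X Y) : Prop :=
  forall W (f g : hom Y W), f ∘ e = g ∘ e -> f = g.

Record functor (C D : category) := Functor {
  fob :> C -> D;
  fmap : forall X Y, hom X Y -> hom (fob X) (fob Y);
  fmap1 : forall X, fmap (idm X) = idm (fob X);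
  fmapM : forall X Y Z (g : hom Y Z) (f : hom X Y),
    fmap (g ∘ f) = fmap g ∘ fmap f }.
Arguments fmap {C D} F {X Y} f : rename.

Record cocone (J C : category) (D : functor J C) := Cocone {
  apex : C;
  leg : forall j, hom (D j) apex;
  leg_nat : forall j k (u : hom j k), leg k ∘ fmap D u = leg j }.

Definition is_colimit (J C : category) (D : functor J C) (c : cocone D) : Prop :=
  forall c' : cocone D,
    exists! f : hom (apex c) (apex c'), forall j, f ∘ leg c j = leg c' j.

Definition cocomplete (C : category) : Prop :=
  forall (J : small_category) (D : functor J C), exists c : cocone D, is_colimit c.

Lemma colimit_epi (J C : category) (D : functor J C) (c : cocone D) :
  is_colimit c -> forall B (u v : hom (apex c) B),
  (forall j, u ∘ leg c j = v ∘ leg c j) -> u = v.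
Proof.
move=> Hc B u v e.
have N j k (w : hom j k) : u ∘ leg c k ∘ fmap D w = u ∘ leg c j.
  by rewrite -mcompA leg_nat.
have [h [_ Uh]] := Hc (Cocone N).
by rewrite -(Uh u) // -(Uh v).
Qed.

Program Definition comp_functor (C D E : category) (G : functor D E)
    (F : functor C D) : functor C E :=
  {| fob := fun X => G (F X); fmap := fun X Y f => fmap G (fmap F f) |}.
Next Obligation. by move=> C D E G F X /=; rewrite !fmap1. Qed.
Next Obligation. by move=> C D E G F X Y Z g f /=; rewrite !fmapM. Qed.

Program Definition map_cocone (J C E : category) (D : functor J C)
    (F : functor C E) (c : cocone D) : cocone (comp_functor F D) :=
  {| apex := F (apex c); leg := fun j => fmap F (leg c j) |}.
Next Obligation. by move=> J C E D F c j k u /=; rewrite -fmapM leg_nat. Qed.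

Program Definition sets : category :=
  {| ob := U; hom := fun S T => S -> T;
     cat_laws := {| idm_ := fun S x => x; mcomp_ := fun R S T g f x => g (f x) |} |}.
Solve All Obligations with by [].

Program Definition hom_set (C : category) (A : C) : functor C sets :=
  {| fob := fun X => hom A X : sets; fmap := fun X Y f g => f ∘ g |}.
Next Obligation.
by move=> C A X; apply: functional_extensionality => g; rewrite mcomp1m.
Qed.
Next Obligation.
by move=> C A X Y Z g f; apply: functional_extensionality => h; rewrite -mcompA.
Qed.

Record arrow (C : category) := Arrow {
  adom : C; acod : C; amap :> hom adom acod }.

Record square (C : category) (f g : arrow C) : U := Square {
  sq_dom : hom (adom f) (adom g);
  sq_cod : hom (acod f) (acod g);
  sq_comm : g ∘ sq_dom = sq_cod ∘ f }.

Lemma square_eq (C : category) (f g : arrow C) (s t : square f g) :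
  sq_dom s = sq_dom t -> sq_cod s = sq_cod t -> s = t.
Proof.
case: s t => s1 s2 sc [t1 t2 tc] /= e1 e2; subst; f_equal.
exact: proof_irrelevance.
Qed.

Program Definition arrow_category (C : category) : category :=
  {| ob := arrow C; hom := @square C;
     cat_laws := {|
       idm_ := fun f => {| sq_dom := idm (adom f); sq_cod := idm (acod f) |};
       mcomp_ := fun f g h s t =>
         {| sq_dom := sq_dom s ∘ sq_dom t; sq_cod := sq_cod s ∘ sq_cod t |} |} |}.
Next Obligation. by move=> C f; rewrite mcompm1 mcomp1m. Qed.
Next Obligation.
by move=> C f g h s t; rewrite mcompA sq_comm -mcompA sq_comm mcompA.
Qed.
Next Obligation. by move=> C f g s; apply: square_eq; apply: mcomp1m. Qed.
Next Obligation. by move=> C f g s; apply: square_eq; apply: mcompm1. Qed.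
Next Obligation. by move=> C f g h k r s t; apply: square_eq; apply: mcompA. Qed.

Section Presentable.
Variable lam : regular_cardinal.

Definition small_lt (J : small_category) : Prop :=
  card_lt {x : sob J & {y : sob J & shom x y}} lam.

Definition filtered (J : small_category) : Prop :=
  forall K : small_category, small_lt K ->
  forall D : functor K J, inhabited (cocone D).

Definition presentable (C : category) (A : C) : Prop :=
  forall J : small_category, filtered J ->
  forall (D : functor J C) (c : cocone D),
    is_colimit c -> is_colimit (map_cocone (hom_set A) c).

Definition locally_presentable (C : category) : Prop :=
  cocomplete C /\
  exists (I : U) (G : I -> C), (forall i, presentable (G i)) /\
  forall X : C, exists (J : small_category) (D : functor J C) (c : cocone D),
    filtered J /\ (forall j, exists i, D j = G i) /\
    is_colimit c /\ apex c = X.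

End Presentable.

(* A wide pullback of cospans  A -> P j <- Q j  with common source A. *)
Record wcone (C : category) (A : C) (J : U) (P Q : J -> C)
    (f : forall j, hom A (P j)) (g : forall j, hom (Q j) (P j)) := WCone {
  wapex : C;
  wbase : hom wapex A;
  wleg : forall j, hom wapex (Q j);
  wcomm : forall j, f j ∘ wbase = g j ∘ wleg j }.

Definition is_wide_pullback (C : category) (A : C) (J : U) (P Q : J -> C)
    (f : forall j, hom A (P j)) (g : forall j, hom (Q j) (P j))
    (w : wcone f g) : Prop :=
  forall w' : wcone f g, exists! h : hom (wapex w') (wapex w),
    wbase w ∘ h = wbase w' /\ forall j, wleg w j ∘ h = wleg w' j.

Record econe (C : category) (A B : C) (s t : hom A B) := ECone {
  eapex : C;
  eleg : hom eapex A;
  ecomm : s ∘ eleg = t ∘ eleg }.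

Definition is_equalizer (C : category) (A B : C) (s t : hom A B)
    (w : econe s t) : Prop :=
  forall w' : econe s t, exists! h : hom (eapex w') (eapex w),
    eleg w ∘ h = eleg w'.

(* Coequalizers are colimits of shape [parallel_pair]. *)
Definition pp_hom (a b : bool) : Set :=
  match a, b with
  | false, true => bool
  | true, false => Empty_set
  | _, _ => unit
  end.

Program Definition parallel_pair : small_category :=
  {| sob := bool; shom := pp_hom;
     scat_laws := {|
       idm_ := fun a => match a with true => tt | false => tt end;
       mcomp_ := fun a b c =>
         match a, b, c return pp_hom b c -> pp_hom a b -> pp_hom a c with
         | false, false, true => fun g _ => g
         | false, true, true => fun _ f => f
         | false, false, false => fun _ _ => tt
         | true, true, true => fun _ _ => tt
         | true, true, false => fun g _ => g
         | true, false, false => fun _ f => f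
         | true, false, true => fun _ _ => tt
         | false, true, false => fun _ _ => tt
         end |} |}.
Next Obligation. by case=> [] [] // []. Qed.
Next Obligation. by case=> [] [] // []. Qed.
Next Obligation. by case=> [] [] [] [] //= [] //= [] //= []. Qed.

Program Definition pp_functor (C : category) (X Y : C) (f g : hom X Y) :
    functor parallel_pair C :=
  {| fob := fun a : parallel_pair => if a then Y else X;
     fmap := fun a b : bool =>
       match a, b return pp_hom a b -> hom (if a then Y else X) (if b then Y else X) with
       | false, true => fun u => if u then f else g
       | true, false => fun u => match u with end
       | true, true => fun _ => idm Y
       | false, false => fun _ => idm X
       end |}.
Next Obligation. by move=> C X Y f g []. Qed.
Next Obligation.
by move=> C X Y f g [] [] [] //= u v; rewrite ?mcomp1m ?mcompm1 //; case: u v.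
Qed.

(* A cocomplete category in which every object is a small colimit of objects
   from a fixed small family represents every presheaf turning colimits into
   limits: the colimit over the elements of F is weakly terminal among all
   elements, and its quotient by all endomorphisms is terminal. *)
Section Representability.
Variables (C : category) (HC : cocomplete C) (I : U) (G : I -> C).
Hypothesis HG : forall X : C,
  exists (J : small_category) (D : functor J C) (c : cocone D),
    (forall j, exists i, D j = G i) /\ is_colimit c /\ apex c = X.
Variables (F : C -> U) (F1 : forall X Y, hom X Y -> F Y -> F X).
Hypothesis F11 : forall X x, F1 (idm X) x = x.
Hypothesis F1M : forall X Y Z (g : hom Y Z) (f : hom X Y) x,
  F1 (g ∘ f) x = F1 f (F1 g x).
Hypothesis Fcont : forall (J : small_category) (D : functor J C) (c : cocone D),
  is_colimit c -> forall x : (forall j, F (D j)),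
  (forall j k (u : hom j k), F1 (fmap D u) (x k) = x j) ->
  exists y, forall j, F1 (leg c j) y = x j.
Hypothesis Fsep : forall (J : small_category) (D : functor J C) (c : cocone D),
  is_colimit c -> forall y z : F (apex c),
  (forall j, F1 (leg c j) y = F1 (leg c j) z) -> y = z.

Record elements_hom (a b : {i : I & F (G i)}) : U := ElementsHom {
  eh_hom : hom (G (projT1 a)) (G (projT1 b));
  eh_elt : F1 eh_hom (projT2 b) = projT2 a }.

Lemma elements_hom_eq a b (f g : elements_hom a b) : eh_hom f = eh_hom g -> f = g.
Proof.
case: f g => f ef [g eg] /= e; subst; f_equal; exact: proof_irrelevance.
Qed.

Program Definition elements : small_category :=
  {| sob := {i : I & F (G i)}; shom := elements_hom;
     scat_laws := {|
       idm_ := fun a => {| eh_hom := idm (G (projT1 a)) |};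
       mcomp_ := fun a b c g f => {| eh_hom := eh_hom g ∘ eh_hom f |} |} |}.
Next Obligation. by move=> a; rewrite F11. Qed.
Next Obligation. by move=> a b c g f; rewrite F1M !eh_elt. Qed.
Next Obligation. by move=> a b f; apply: elements_hom_eq; apply: mcomp1m. Qed.
Next Obligation. by move=> a b f; apply: elements_hom_eq; apply: mcompm1. Qed.
Next Obligation. by move=> a b c d h g f; apply: elements_hom_eq; apply: mcompA. Qed.

Program Definition elements_proj : functor elements C :=
  {| fob := fun a : elements => G (projT1 a); fmap := fun a b f => eh_hom f |}.
Solve All Obligations with by [].

Let in_elt (c : cocone elements_proj) (Y : C) (i : {i | Y = G i}) (y : F Y) :
  hom Y (apex c).
Proof. by case: i => i e; subst Y; exact: (leg c (existT _ i y : elements)). Defined.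

Let in_elt_nat (c : cocone elements_proj) (Y Z : C) i k (h : hom Y Z) (z : F Z) :
  in_elt c k z ∘ h = in_elt c i (F1 h z).
Proof.
case: i k => i ei [k ek]; subst Y Z => /=.
pose a : elements := existT _ i (F1 h z).
pose b : elements := existT _ k z.
exact: (leg_nat c (@ElementsHom a b h erefl : hom a b)).
Qed.

Let in_eltE (c : cocone elements_proj) (l : F (apex c)) (Y : C) i (y : F Y) :
  (forall a : elements, F1 (leg c a) l = projT2 a) -> F1 (in_elt c i y) l = y.
Proof. by case: i => i e Hl; subst Y; exact: (Hl (existT _ i y)). Qed.

Lemma weakly_terminal_element :
  exists (L : C) (l : F L), forall X (x : F X), exists h : hom X L, F1 h l = x.
Proof.
have [c Hc] := HC elements_proj.
have [l Hl] := Fcont Hc (x := fun a : elements => projT2 a)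
                 (fun j k u => eh_elt u).
exists (apex c), l => X x.
have [J [D [d [HD [Hd eX]]]]] := HG X; subst X.
pose i j := constructive_indefinite_description _ (HD j).
have dN j k (u : hom j k) :
    in_elt c (i k) (F1 (leg d k) x) ∘ fmap D u = in_elt c (i j) (F1 (leg d j) x).
  by rewrite (in_elt_nat c (i j)) -F1M leg_nat.
have [h [Hh _]] := Hd (Cocone dN).
exists h; apply: (Fsep Hd) => j.
by rewrite -F1M Hh /= in_eltE.
Qed.

Lemma coequalizer (X Y : C) (f g : hom X Y) (y : F Y) : F1 f y = F1 g y ->
  exists (Q : C) (q : hom Y Q) (z : F Q), q ∘ f = q ∘ g /\ F1 q z = y.
Proof.
move=> e; have [c Hc] := HC (pp_functor f g).
have Hx (j k : parallel_pair) (u : hom j k) :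
    F1 (fmap (pp_functor f g) u)
       ((if k as b return F (if b then Y else X) then y else F1 f y)) =
    (if j as b return F (if b then Y else X) then y else F1 f y).
  by case: j k u => [] [] // [] //=.
have [z Hz] := Fcont Hc Hx.
exists (apex c), (leg c (true : parallel_pair)), z; split; last exact: (Hz true).
have := leg_nat c (j := false : parallel_pair) (k := true) true.
have := leg_nat c (j := false : parallel_pair) (k := true) false.
by move=> /= -> ->.
Qed.

Record endo (L : C) (l : F L) : U := Endo {
  en_hom : hom L L;
  en_elt : F1 en_hom l = l }.

Lemma endo_eq L (l : F L) (f g : endo l) : en_hom f = en_hom g -> f = g.
Proof.
case: f g => f ef [g eg] /= e; subst; f_equal; exact: proof_irrelevance.
Qed.

Program Definition endos L (l : F L) : small_category :=
  {| sob := unit; shom := fun _ _ => endo l;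
     scat_laws := {|
       idm_ := fun _ => {| en_hom := idm L |};
       mcomp_ := fun _ _ _ g f => {| en_hom := en_hom g ∘ en_hom f |} |} |}.
Next Obligation. by move=> L l ?; rewrite F11. Qed.
Next Obligation. by move=> L l ? ? ? g f; rewrite F1M !en_elt. Qed.
Next Obligation. by move=> L l ? ? f; apply: endo_eq; apply: mcomp1m. Qed.
Next Obligation. by move=> L l ? ? f; apply: endo_eq; apply: mcompm1. Qed.
Next Obligation. by move=> L l ? ? ? ? h g f; apply: endo_eq; apply: mcompA. Qed.

Program Definition endos_proj L (l : F L) : functor (endos l) C :=
  {| fob := fun _ => L; fmap := fun a b f => en_hom f |}.
Solve All Obligations with by [].

Lemma representable :
  exists (T : C) (t : F T), forall X (x : F X), exists! h : hom X T, F1 h t = x.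
Proof.
have [L [l Ll]] := weakly_terminal_element.
have [c Hc] := HC (endos_proj l).
have [t Ht] := Fcont Hc (x := fun _ => l) (fun j k u => en_elt u).
exists (apex c), t; pose q := leg c tt : hom L (apex c).
have Hq : F1 q t = l by exact: Ht.
have qepi Z (f g : hom (apex c) Z) : f ∘ q = g ∘ q -> f = g.
  by move=> e; apply: (colimit_epi Hc) => -[].
move=> X x; have [h Hh] := Ll X x.
exists (q ∘ h); split; first by rewrite F1M Hq.
suff fg (f g : hom X (apex c)) : F1 f t = F1 g t -> f = g.
  by move=> g Hg; apply: fg; rewrite Hg F1M Hq.
move=> e; have [Q [p [z [pe Hz]]]] := coequalizer e.
have [w Hw] := Ll Q z.
have En : F1 (w ∘ (p ∘ q)) l = l by rewrite F1M Hw F1M Hz.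
have N : q ∘ (w ∘ (p ∘ q)) = q
  := leg_nat c (Endo En : hom (tt : endos l) (tt : endos l)).
have S : q ∘ w ∘ p = idm _ by apply: qepi; rewrite mcomp1m -[RHS]N !mcompA.
by rewrite -[f]mcomp1m -[g]mcomp1m -S -!mcompA pe.
Qed.

End Representability.

Section LocallyPresentableLimits.
Variables (lam : regular_cardinal) (C : category).
Hypothesis HC : locally_presentable lam C.

Lemma wide_pullback_exists (A : C) (J : U) (P Q : J -> C)
    (f : forall j, hom A (P j)) (g : forall j, hom (Q j) (P j)) :
  exists w : wcone f g, is_wide_pullback w.
Proof.
have [HC1 [I [G [_ HG]]]] := HC.
pose F (W : C) : U := {pq : hom W A * (forall j, hom W (Q j)) |
  forall j, f j ∘ pq.1 = g j ∘ pq.2 j}.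
have FE W (x y : F W) : (sval x).1 = (sval y).1 ->
    (forall j, (sval x).2 j = (sval y).2 j) -> x = y.
  case: x y => [[p q] c] [[p' q'] c'] /= e1 e2; subst p'.
  have e : q = q' by apply: functional_extensionality_dep.
  by subst q'; f_equal; apply: proof_irrelevance.
have HF1 X Y (h : hom X Y) (x : F Y) j :
    f j ∘ ((sval x).1 ∘ h) = g j ∘ ((sval x).2 j ∘ h).
  by rewrite !mcompA (proj2_sig x).
pose F1 X Y (h : hom X Y) (x : F Y) : F X :=
  exist _ ((sval x).1 ∘ h, fun j => (sval x).2 j ∘ h) (HF1 X Y h x).
have [T [t Ht]] : exists (T : C) (t : F T),
    forall X (x : F X), exists! h : hom X T, F1 X T h t = x.
{ apply: (@representable C HC1 I G _ F F1).
  - move=> X; have [J' [D [c [_ [H1 [H2 H3]]]]]] := HG X; by exists J', D, c.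
  - by move=> X x; apply: FE => [|j] /=; rewrite mcompm1.
  - by move=> X Y Z k h x; apply: FE => [|j] /=; rewrite mcompA.
  - move=> J' D c Hc x Hx.
    have N j k (u : hom j k) : (sval (x k)).1 ∘ fmap D u = (sval (x j)).1.
      by rewrite -(Hx j k u).
    have [p [Hp _]] := Hc (Cocone N).
    have N' i j k (u : hom j k) : (sval (x k)).2 i ∘ fmap D u = (sval (x j)).2 i.
      by rewrite -(Hx j k u).
    have q_ i := constructive_indefinite_description _ (Hc (Cocone (N' i))).
    have Hpq i : f i ∘ p = g i ∘ sval (q_ i).
      apply: (colimit_epi Hc) => j; have [Hq _] := proj2_sig (q_ i).
      by rewrite -!mcompA Hp Hq (proj2_sig (x j)).
    exists (exist _ (p, fun i => sval (q_ i)) Hpq) => j.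
    apply: FE => [|i] /=; first exact: Hp.
    have [Hq _] := proj2_sig (q_ i); exact: Hq.
  - move=> J' D c Hc y z Hyz.
    apply: FE => [|i]; apply: (colimit_epi Hc) => j.
      exact: (f_equal (fun x => (sval x).1) (Hyz j)).
    exact: (f_equal (fun x => (sval x).2 i) (Hyz j)). }
exists (WCone (proj2_sig t)) => w'.
have [h [Hh Uh]] := Ht _ (exist _ (wbase w', wleg w') (@wcomm _ _ _ _ _ _ _ w') : F (wapex w')).
exists h; split.
  split=> [|j]; first exact: (f_equal (fun x => (sval x).1) Hh).
  exact: (f_equal (fun x => (sval x).2 j) Hh).
by move=> k [Hk1 Hk2]; apply: Uh; apply: FE.
Qed.

Lemma equalizer_exists (A B : C) (s t : hom A B) :
  exists w : econe s t, is_equalizer w.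
Proof.
have [HC1 [I [G [_ HG]]]] := HC.
pose F (W : C) : U := {h : hom W A | s ∘ h = t ∘ h}.
have FE W (x y : F W) : sval x = sval y -> x = y.
  by case: x y => [h c] [h' c'] /= e; subst h'; f_equal; apply: proof_irrelevance.
have HF1 X Y (h : hom X Y) (x : F Y) : s ∘ (sval x ∘ h) = t ∘ (sval x ∘ h).
  by rewrite !mcompA (proj2_sig x).
pose F1 X Y (h : hom X Y) (x : F Y) : F X := exist _ (sval x ∘ h) (HF1 X Y h x).
have [T [r Hr]] : exists (T : C) (r : F T),
    forall X (x : F X), exists! h : hom X T, F1 X T h r = x.
{ apply: (@representable C HC1 I G _ F F1).
  - by move=> X; have [J' [D [c [_ [H1 [H2 H3]]]]]] := HG X; exists J', D, c.
  - by move=> X x; apply: FE; rewrite /= mcompm1.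
  - by move=> X Y Z k h x; apply: FE; rewrite /= mcompA.
  - move=> J' D c Hc x Hx.
    have N j k (u : hom j k) : sval (x k) ∘ fmap D u = sval (x j).
      by rewrite -(Hx j k u).
    have [p [Hp _]] := Hc (Cocone N).
    have Hst : s ∘ p = t ∘ p.
      by apply: (colimit_epi Hc) => j; rewrite -!mcompA Hp (proj2_sig (x j)).
    by exists (exist _ p Hst) => j; apply: FE; apply: Hp.
  - move=> J' D c Hc y z Hyz; apply: FE; apply: (colimit_epi Hc) => j.
    exact: (f_equal sval (Hyz j)). }
exists (ECone (proj2_sig r)) => w'.
have [h [Hh Uh]] := Hr _ (exist _ (eleg w') (ecomm w') : F (eapex w')).
exists h; split; first exact: (f_equal sval Hh).
by move=> k Hk; apply: Uh; apply: FE.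
Qed.

End LocallyPresentableLimits.

Record smcc := Smcc {
  smcc_cat :> category;
  unit_ob : smcc_cat;
  tensor : smcc_cat -> smcc_cat -> smcc_cat;
  tensorm : forall X X' Y Y' : smcc_cat,
    hom X X' -> hom Y Y' -> hom (tensor X Y) (tensor X' Y');
  tensorm1 : forall X Y : smcc_cat,
    tensorm (idm X) (idm Y) = idm (tensor X Y);
  tensormM : forall (X X' X'' Y Y' Y'' : smcc_cat) (f' : hom X' X'') (f : hom X X')
    (g' : hom Y' Y'') (g : hom Y Y'),
    tensorm (f' ∘ f) (g' ∘ g) = tensorm f' g' ∘ tensorm f g;

  assoc : forall X Y Z, hom (tensor (tensor X Y) Z) (tensor X (tensor Y Z));
  assoc_inv : forall X Y Z, hom (tensor X (tensor Y Z)) (tensor (tensor X Y) Z);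
  assocK : forall X Y Z, assoc_inv X Y Z ∘ assoc X Y Z = idm _;
  assoc_invK : forall X Y Z, assoc X Y Z ∘ assoc_inv X Y Z = idm _;
  assoc_nat : forall (X X' Y Y' Z Z' : smcc_cat)
    (f : hom X X') (g : hom Y Y') (h : hom Z Z'),
    assoc X' Y' Z' ∘ tensorm (tensorm f g) h =
    tensorm f (tensorm g h) ∘ assoc X Y Z;

  lunit : forall X, hom (tensor unit_ob X) X;
  lunit_inv : forall X, hom X (tensor unit_ob X);
  lunitK : forall X, lunit_inv X ∘ lunit X = idm _;
  lunit_invK : forall X, lunit X ∘ lunit_inv X = idm _;
  lunit_nat : forall (X Y : smcc_cat) (f : hom X Y),
    lunit Y ∘ tensorm (idm unit_ob) f = f ∘ lunit X;

  runit : forall X, hom (tensor X unit_ob) X;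
  runit_inv : forall X, hom X (tensor X unit_ob);
  runitK : forall X, runit_inv X ∘ runit X = idm _;
  runit_invK : forall X, runit X ∘ runit_inv X = idm _;
  runit_nat : forall (X Y : smcc_cat) (f : hom X Y),
    runit Y ∘ tensorm f (idm unit_ob) = f ∘ runit X;

  pentagon : forall X Y Z W,
    assoc X Y (tensor Z W) ∘ assoc (tensor X Y) Z W =
    tensorm (idm X) (assoc Y Z W) ∘ assoc X (tensor Y Z) W
      ∘ tensorm (assoc X Y Z) (idm W);
  triangle : forall X Y,
    tensorm (idm X) (lunit Y) ∘ assoc X unit_ob Y = tensorm (runit X) (idm Y);
  lunit_runit : lunit unit_ob = runit unit_ob;

  braid : forall X Y, hom (tensor X Y) (tensor Y X);
  braid_nat : forall (X X' Y Y' : smcc_cat) (f : hom X X') (g : hom Y Y'),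
    braid X' Y' ∘ tensorm f g = tensorm g f ∘ braid X Y;
  braidK : forall X Y, braid Y X ∘ braid X Y = idm _;
  hexagon : forall X Y Z,
    assoc Y Z X ∘ braid X (tensor Y Z) ∘ assoc X Y Z =
    tensorm (idm Y) (braid X Z) ∘ assoc Y X Z ∘ tensorm (braid X Y) (idm Z);
  lunit_braid : forall X, lunit X ∘ braid X unit_ob = runit X;

  ihom : smcc_cat -> smcc_cat -> smcc_cat;
  ev : forall X A, hom (tensor (ihom X A) X) A;
  curry : forall Z X A, hom (tensor Z X) A -> hom Z (ihom X A);
  ev_curry : forall Z X A (f : hom (tensor Z X) A),
    ev X A ∘ tensorm (curry f) (idm X) = f;
  curry_ev : forall Z X A (g : hom Z (ihom X A)),
    curry (ev X A ∘ tensorm g (idm X)) = g }.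

Arguments unit_ob {s}.
Notation "X ⊗ Y" := (tensor X Y) (at level 38, left associativity) : cat_scope.
Notation "f ⊗₁ g" := (tensorm f g) (at level 38, left associativity) : cat_scope.
Notation "A ^ X" := (ihom X A) : cat_scope.

Section Closed.
Variable V : smcc.

(* The maps  A^f : A^Y -> A^X  and  f^X : A^X -> B^X. *)
Definition pre (X Y A : V) (f : hom X Y) : hom (A ^ Y) (A ^ X) :=
  curry (ev Y A ∘ (idm (A ^ Y) ⊗₁ f)).
Definition post (X A B : V) (f : hom A B) : hom (A ^ X) (B ^ X) :=
  curry (f ∘ ev X A).

Definition icomp (A B C : V) : hom (C ^ B ⊗ B ^ A) (C ^ A) :=
  curry (ev B C ∘ (idm (C ^ B) ⊗₁ ev A B) ∘ assoc (C ^ B) (B ^ A) A).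
Definition iid (A : V) : hom unit_ob (A ^ A) := curry (lunit A).

(* The canonical isomorphism  (A^X)^Y -> A^(X ⊗ Y). *)
Definition uncurry2 (X Y A : V) : hom ((A ^ X) ^ Y) (A ^ (X ⊗ Y)) :=
  curry (ev X A ∘ (ev Y (A ^ X) ⊗₁ idm X) ∘ assoc_inv ((A ^ X) ^ Y) Y X
           ∘ (idm ((A ^ X) ^ Y) ⊗₁ braid X Y)).

(* The element  I -> A^X  corresponding to  a : X -> A. *)
Definition transpose (X A : V) (a : hom X A) : hom unit_ob (A ^ X) :=
  curry (a ∘ lunit X).

Lemma tensorm_lr (X X' Y Y' : V) (f : hom X X') (g : hom Y Y') :
  (f ⊗₁ idm Y') ∘ (idm X ⊗₁ g) = f ⊗₁ g.
Proof. by rewrite -tensormM mcompm1 mcomp1m. Qed.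

Lemma tensorm_rl (X X' Y Y' : V) (f : hom X X') (g : hom Y Y') :
  (idm X' ⊗₁ g) ∘ (f ⊗₁ idm Y) = f ⊗₁ g.
Proof. by rewrite -tensormM mcompm1 mcomp1m. Qed.

Lemma tensormMl (Z W T S : V) (g : hom W T) (f : hom Z W) :
  (g ∘ f) ⊗₁ idm S = (g ⊗₁ idm S) ∘ (f ⊗₁ idm S).
Proof. by rewrite -tensormM mcomp1m. Qed.

Lemma tensormMr (Z W T S : V) (g : hom W T) (f : hom Z W) :
  idm S ⊗₁ (g ∘ f) = (idm S ⊗₁ g) ∘ (idm S ⊗₁ f).
Proof. by rewrite -tensormM mcomp1m. Qed.

Lemma unit_tensor_faithful (X Y : V) (f g : hom X Y) :
  idm unit_ob ⊗₁ f = idm unit_ob ⊗₁ g -> f = g.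
Proof.
move=> e.
rewrite -[f]mcompm1 -[g]mcompm1 -(lunit_invK X) !mcompA -!lunit_nat.
by rewrite e.
Qed.

Lemma lunit_tensor (X Y : V) : lunit (X ⊗ Y) ∘ assoc unit_ob X Y = lunit X ⊗₁ idm Y.
Proof.
apply: unit_tensor_faithful.
have iso_epi W (f g : hom (unit_ob ⊗ (unit_ob ⊗ X ⊗ Y)) W) :
    f ∘ assoc _ _ _ ∘ (assoc _ _ _ ⊗₁ idm Y) =
    g ∘ assoc _ _ _ ∘ (assoc _ _ _ ⊗₁ idm Y) -> f = g.
  move=> e; have /= := f_equal (fun h => h ∘ (assoc_inv _ _ _ ⊗₁ idm Y)) e.
  rewrite -!(mcompA _ (_ ⊗₁ _)) -tensormMl assoc_invK tensorm1 !mcompm1 => {}e.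
  have /= := f_equal (fun h => h ∘ assoc_inv _ _ _) e.
  by rewrite -!mcompA assoc_invK !mcompm1.
apply: iso_epi.
rewrite -assoc_nat -[in RHS]mcompA -tensormMl triangle assoc_nat tensorm1 -triangle.
by rewrite -[in RHS]mcompA pentagon tensormMr !mcompA.
Qed.

Lemma uncurry_inj (Z X A : V) (f g : hom Z (A ^ X)) :
  ev X A ∘ (f ⊗₁ idm X) = ev X A ∘ (g ⊗₁ idm X) -> f = g.
Proof. by move=> e; rewrite -[f]curry_ev e curry_ev. Qed.

Lemma curry_comp (W Z X A : V) (f : hom (Z ⊗ X) A) (h : hom W Z) :
  curry f ∘ h = curry (f ∘ (h ⊗₁ idm X)).
Proof.
apply: uncurry_inj.
by rewrite -[X in _ ⊗₁ X]mcomp1m tensormM mcompA !ev_curry.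
Qed.

Lemma ev_post (Z X A B : V) (f : hom A B) (h : hom Z (A ^ X)) :
  ev X B ∘ ((post X f ∘ h) ⊗₁ idm X) = f ∘ ev X A ∘ (h ⊗₁ idm X).
Proof. by rewrite /post curry_comp ev_curry. Qed.

Lemma post_comp (X A B C : V) (g : hom B C) (f : hom A B) :
  post X (g ∘ f) = post X g ∘ post X f.
Proof. by apply: uncurry_inj; rewrite ev_post /post ev_curry -[RHS]mcompA ev_curry mcompA. Qed.

Lemma post_mono (X A B : V) (f : hom A B) : mono f -> mono (post X f).
Proof.
move=> Hf W g h e; apply: uncurry_inj; apply: Hf.
by rewrite !mcompA -!ev_post e.
Qed.

Lemma ev_pre (Z X Y A : V) (f : hom X Y) (h : hom Z (A ^ Y)) :
  ev X A ∘ ((pre A f ∘ h) ⊗₁ idm X) = ev Y A ∘ (h ⊗₁ f).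
Proof. by rewrite /pre curry_comp ev_curry -mcompA tensorm_rl. Qed.

Lemma ev_icomp (A B C : V) :
  ev A C ∘ (icomp A B C ⊗₁ idm A) =
  ev B C ∘ (idm (C ^ B) ⊗₁ ev A B) ∘ assoc (C ^ B) (B ^ A) A.
Proof. by rewrite /icomp ev_curry. Qed.

Lemma icompA (A B C D : V) :
  icomp A B D ∘ (icomp B C D ⊗₁ idm (B ^ A)) =
  icomp A C D ∘ (idm (D ^ C) ⊗₁ icomp A B C) ∘ assoc (D ^ C) (C ^ B) (B ^ A).
Proof.
apply: uncurry_inj.
transitivity (ev C D ∘ (idm _ ⊗₁ ev B C) ∘ (idm _ ⊗₁ (idm _ ⊗₁ ev A B))
  ∘ (assoc (D ^ C) (C ^ B) (B ^ A ⊗ A) ∘ assoc (D ^ C ⊗ C ^ B) (B ^ A) A)).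
  rewrite tensormMl mcompA ev_icomp -mcompA assoc_nat tensorm1 mcompA.
  rewrite -(mcompA (ev B D)) tensorm_rl -tensorm_lr mcompA ev_icomp.
  by rewrite -tensorm1 -(mcompA _ (assoc _ _ _)) assoc_nat !mcompA.
rewrite pentagon !tensormMl !mcompA ev_icomp.
rewrite -(mcompA _ (assoc _ _ _) (_ ⊗₁ _ ⊗₁ _)) assoc_nat !mcompA.
rewrite -!(mcompA (ev C D)) -!tensormMr ev_icomp.
by rewrite !tensormMr !mcompA.
Qed.

Lemma icomp1m (A B : V) : icomp A B B ∘ (iid B ⊗₁ idm (B ^ A)) = lunit (B ^ A).
Proof.
apply: uncurry_inj.
rewrite tensormMl mcompA ev_icomp -mcompA assoc_nat tensorm1 mcompA.
rewrite -(mcompA (ev B B)) tensorm_rl -tensorm_lr mcompA ev_curry.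
by rewrite lunit_nat -mcompA lunit_tensor.
Qed.

Lemma icompm1 (A B : V) : icomp A A B ∘ (idm (B ^ A) ⊗₁ iid A) = runit (B ^ A).
Proof.
apply: uncurry_inj.
rewrite tensormMl mcompA ev_icomp -mcompA assoc_nat mcompA.
by rewrite -(mcompA (ev A B)) -tensormMr ev_curry -mcompA triangle.
Qed.
End Closed.

Record Vcategory (V : smcc) := VCategory {
  vob :> Type;
  vhom : vob -> vob -> V;
  vid : forall a, hom unit_ob (vhom a a);
  vcomp : forall a b c, hom (vhom b c ⊗ vhom a b) (vhom a c);
  vcomp1m : forall a b,
    vcomp a b b ∘ (vid b ⊗₁ idm (vhom a b)) = lunit (vhom a b);
  vcompm1 : forall a b,
    vcomp a a b ∘ (idm (vhom a b) ⊗₁ vid a) = runit (vhom a b);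
  vcompA : forall a b c d,
    vcomp a b d ∘ (vcomp b c d ⊗₁ idm (vhom a b)) =
    vcomp a c d ∘ (idm (vhom c d) ⊗₁ vcomp a b c)
      ∘ assoc (vhom c d) (vhom b c) (vhom a b) }.

Section Enriched.
Variables (V : smcc) (K : Vcategory V).

(* The actions  K(a,f) : K(a,b) -> K(a,c)  and  K(f,c) : K(b,c) -> K(a,c)  of
   elements  f : I -> K(b,c)  and  f : I -> K(a,b). *)
Definition vpost (a b c : K) (f : hom unit_ob (vhom b c)) :
  hom (vhom a b) (vhom a c) :=
  vcomp a b c ∘ (f ⊗₁ idm (vhom a b)) ∘ lunit_inv (vhom a b).
Definition vpre (a b c : K) (f : hom unit_ob (vhom a b)) :
  hom (vhom b c) (vhom a c) :=
  vcomp a b c ∘ (idm (vhom b c) ⊗₁ f) ∘ runit_inv (vhom b c).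

Definition under_comp (a b c : K) (g : hom unit_ob (vhom b c))
  (f : hom unit_ob (vhom a b)) : hom unit_ob (vhom a c) :=
  vcomp a b c ∘ (g ⊗₁ f) ∘ lunit_inv unit_ob.

Lemma lunit_inv_nat (X Y : V) (f : hom X Y) :
  lunit_inv Y ∘ f = (idm unit_ob ⊗₁ f) ∘ lunit_inv X.
Proof.
rewrite -[lunit_inv Y ∘ f]mcompm1 -(lunit_invK X) -!mcompA (mcompA f) -lunit_nat.
by rewrite -mcompA (mcompA (lunit_inv Y)) lunitK mcomp1m.
Qed.

Lemma under_compE (a b c : K) (g : hom unit_ob (vhom b c))
  (f : hom unit_ob (vhom a b)) : under_comp g f = vpost a g ∘ f.
Proof.
rewrite /vpost -[in RHS]mcompA lunit_inv_nat [in RHS]mcompA.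
by rewrite -[in RHS](mcompA (vcomp a b c)) tensorm_lr.
Qed.

Lemma assoc_lunit_inv (X : V) :
  assoc unit_ob unit_ob X ∘ (lunit_inv unit_ob ⊗₁ idm X) =
  idm unit_ob ⊗₁ lunit_inv X.
Proof.
rewrite -[LHS]mcomp1m -tensorm1 -(lunitK X) tensormMr -mcompA.
rewrite (mcompA _ (assoc _ _ _)) triangle -tensormMl -lunit_runit lunit_invK.
by rewrite tensorm1 mcompm1.
Qed.

Lemma vpostM (a b c d : K) (g : hom unit_ob (vhom c d)) (f : hom unit_ob (vhom b c)) :
  vpost a (under_comp g f) = vpost a g ∘ vpost a f.
Proof.
rewrite /vpost /under_comp !tensormMl !mcompA vcompA.
rewrite -(mcompA _ (assoc _ _ _)) assoc_nat !mcompA.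
rewrite -(mcompA _ (assoc _ _ _)) assoc_lunit_inv.
have -> : vcomp a c d ∘ (g ⊗₁ idm _) ∘ lunit_inv (vhom a c) ∘ vcomp a b c
    ∘ (f ⊗₁ idm _) ∘ lunit_inv (vhom a b) =
  vcomp a c d ∘ (g ⊗₁ idm _) ∘ ((idm _ ⊗₁ vcomp a b c) ∘
    (idm _ ⊗₁ (f ⊗₁ idm _)) ∘ (idm _ ⊗₁ lunit_inv (vhom a b)) ∘
    lunit_inv (vhom a b)).
  by rewrite -!tensormMr -lunit_inv_nat !mcompA.
rewrite !mcompA -[in RHS](mcompA _ (g ⊗₁ _)) tensorm_lr.
rewrite -(tensorm_rl g (vcomp a b c)) [in RHS]mcompA.
by rewrite -[in RHS](mcompA _ (g ⊗₁ _)) tensorm_lr.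
Qed.

Lemma vpost1 (a b : K) : vpost a (vid b) = idm (vhom a b).
Proof. by rewrite /vpost vcomp1m lunit_invK. Qed.

Lemma under_comp1m (a b : K) (f : hom unit_ob (vhom a b)) : under_comp (vid b) f = f.
Proof. by rewrite under_compE vpost1 mcomp1m. Qed.

Lemma under_compm1 (a b : K) (f : hom unit_ob (vhom a b)) : under_comp f (vid a) = f.
Proof.
rewrite /under_comp -tensorm_rl mcompA vcompm1 runit_nat -lunit_runit.
by rewrite -mcompA lunit_invK mcompm1.
Qed.

Lemma under_compA (a b c d : K) (h : hom unit_ob (vhom c d))
  (g : hom unit_ob (vhom b c)) (f : hom unit_ob (vhom a b)) :
  under_comp h (under_comp g f) = under_comp (under_comp h g) f.
Proof. by rewrite !under_compE mcompA -vpostM under_compE. Qed.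

Definition underlying : category := {|
  ob := K;
  hom := fun a b => hom unit_ob (vhom a b);
  cat_laws := {|
    idm_ := @vid V K;
    mcomp_ := @under_comp;
    mcomp1m_ := under_comp1m;
    mcompm1_ := under_compm1;
    mcompA_ := under_compA |} |}.

Definition vhom_functor (a : K) : functor underlying V := {|
  fob := fun b : underlying => vhom a b;
  fmap := fun b c f => vpost a f;
  fmap1 := @vpost1 a;
  fmapM := fun b c d g f => vpostM a g f |}.

Definition conical_colimit (J : category) (D : functor J underlying)
    (c : cocone D) : Prop :=
  forall (b : K) (Z : V) (z : forall j, hom Z (vhom (D j) b)),
    (forall j k (u : hom j k), vpre b (fmap D u) ∘ z k = z j) ->
    exists! h : hom Z (vhom (apex c) b), forall j, vpre b (leg c j) ∘ h = z j.

Definition vpresentable (lam : regular_cardinal) (a : K) : Prop :=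
  forall J : small_category, filtered lam J ->
  forall (D : functor J underlying) (c : cocone D),
    conical_colimit c -> is_colimit (map_cocone (vhom_functor a) c).

End Enriched.

Definition orthogonal (C : category) (A B X Y : C) (e : hom A B) (m : hom X Y) : Prop :=
  forall (u : hom A X) (v : hom B Y), m ∘ u = v ∘ e ->
    exists! d : hom B X, d ∘ e = u /\ m ∘ d = v.

Definition map_class (C : category) := forall X Y : C, hom X Y -> Prop.

Record factorization (C : category) (E M : map_class C) (X Y : C) (f : hom X Y) :=
  Factorization {
    fac_ob : C;
    fac_E : hom X fac_ob;
    fac_M : hom fac_ob Y;
    fac_inE : E X fac_ob fac_E;
    fac_inM : M fac_ob Y fac_M;
    fac_comp : fac_M ∘ fac_E = f }.

Record orthogonal_fs (C : category) (E M : map_class C) : Prop := OrthogonalFS {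
  ofs_factor : forall (X Y : C) (f : hom X Y), inhabited (factorization E M f);
  ofs_E : forall (A B : C) (e : hom A B),
    E A B e <-> forall (X Y : C) (m : hom X Y), M X Y m -> orthogonal e m;
  ofs_M : forall (X Y : C) (m : hom X Y),
    M X Y m <-> forall (A B : C) (e : hom A B), E A B e -> orthogonal e m }.

(* Copowers in the arrow category are pointwise: that of e by X is X ⊗ e. *)
Definition enriched_fs (V : smcc) (E M : map_class V) : Prop :=
  orthogonal_fs E M /\
  forall (X A B : V) (e : hom A B), E A B e -> E (X ⊗ A) (X ⊗ B) (idm X ⊗₁ e).

Definition proper_fs (C : category) (E M : map_class C) : Prop :=
  (forall (X Y : C) (e : hom X Y), E X Y e -> epi e) /\
  (forall (X Y : C) (m : hom X Y), M X Y m -> mono m).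

Definition closed_under_filtered (lam : regular_cardinal) (C : category)
    (M : map_class C) : Prop :=
  forall J : small_category, filtered lam J ->
  forall (D : functor J (arrow_category C)) (c : cocone D), is_colimit c ->
    (forall j, M _ _ (amap (D j))) -> M _ _ (amap (apex c)).

Definition locally_presentable_closed (lam : regular_cardinal) (V : smcc) : Prop :=
  locally_presentable lam V /\
  presentable lam (unit_ob : V) /\
  forall X Y : V, presentable lam X -> presentable lam Y -> presentable lam (X ⊗ Y).

Record base (lam : regular_cardinal) := Base {
  base_smcc :> smcc;
  base_lp : locally_presentable_closed lam base_smcc;
  clsE : map_class base_smcc;
  clsM : map_class base_smcc;
  base_fs : enriched_fs clsE clsM;
  base_proper : proper_fs clsE clsM;
  base_filtered : closed_under_filtered lam clsM }.

Definition choose (T : Type) (H : inhabited T) : T :=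
  epsilon H (fun _ => True).

Section Chosen.
Variables (lam : regular_cardinal) (V : base lam).

Definition wide_pullback (A : V) (J : U) (P Q : J -> V)
    (f : forall j, hom A (P j)) (g : forall j, hom (Q j) (P j)) : wcone f g :=
  sval (constructive_indefinite_description _
          (wide_pullback_exists (proj1 (base_lp V)) f g)).

Lemma wide_pullbackP (A : V) (J : U) (P Q : J -> V)
    (f : forall j, hom A (P j)) (g : forall j, hom (Q j) (P j)) :
  is_wide_pullback (wide_pullback f g).
Proof. exact: proj2_sig. Qed.

Definition equalizer (A B : V) (s t : hom A B) : econe s t :=
  sval (constructive_indefinite_description _
          (equalizer_exists (proj1 (base_lp V)) s t)).

Lemma equalizerP (A B : V) (s t : hom A B) : is_equalizer (equalizer s t).
Proof. exact: proj2_sig. Qed.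

Definition factor (X Y : V) (f : hom X Y) : factorization (@clsE _ V) (@clsM _ V) f :=
  choose (ofs_factor (proj1 (base_fs V)) f).

Program Definition two : small_category :=
  {| sob := bool; shom := fun a b => a = b;
     scat_laws := {|
       idm_ := fun a => erefl;
       mcomp_ := fun a b c (g : b = c) (f : a = b) => etrans f g |} |}.
Solve All Obligations with by move=> *; exact: proof_irrelevance.

Program Definition pair_functor (X Y : V) : functor two V :=
  {| fob := fun a : two => if a then Y else X;
     fmap := fun (a b : bool) (u : a = b) =>
       match u in _ = c return
         hom (if a then Y else X) (if c then Y else X) with erefl => idm _ end |}.
Next Obligation. by []. Qed.
Next Obligation.
move=> X Y a b c; rewrite /hom /= => g f; subst c b => /=.
by rewrite mcomp1m.
Qed.

Definition coproduct (X Y : V) : cocone (pair_functor X Y) :=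
  sval (constructive_indefinite_description _
          (proj1 (proj1 (base_lp V)) two (pair_functor X Y))).

Lemma coproductP (X Y : V) : is_colimit (coproduct X Y).
Proof. exact: proj2_sig. Qed.

Definition coprod (X Y : V) : V := apex (coproduct X Y).
Definition coprod_inl (X Y : V) : hom X (coprod X Y) :=
  leg (coproduct X Y) (false : two).
Definition coprod_inr (X Y : V) : hom Y (coprod X Y) :=
  leg (coproduct X Y) (true : two).

End Chosen.

Record language (C : category) := Language {
  symb : U;
  arity : symb -> C }.

Section Structures.
Variables (lam : regular_cardinal) (V : base lam) (L : language V).

Definition lambda_ary : Prop := forall R : symb L, presentable lam (arity R).

Record structure := Structure {
  carrier :> V;
  rel_ob : symb L -> V;
  rel : forall R, hom (rel_ob R) (carrier ^ arity R);
  rel_inM : forall R, clsM (rel R) }.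

Definition is_morphism (A B : structure) (h : hom A B) : Prop :=
  forall R : symb L, exists hR : hom (rel_ob A R) (rel_ob B R),
    rel B R ∘ hR = post (arity R) h ∘ rel A R.

Record morphism (A B : structure) := Morphism {
  mor :> hom A B;
  morP : is_morphism mor }.

Lemma morphism_comp_subproof (A B C : structure) (g : morphism B C)
  (f : morphism A B) : is_morphism (mor g ∘ mor f).
Proof.
move=> R; have [fR Hf] := morP f R; have [gR Hg] := morP g R.
by exists (gR ∘ fR); rewrite mcompA Hg -mcompA Hf mcompA post_comp.
Qed.

Definition morphism_comp (A B C : structure) (g : morphism B C) (f : morphism A B) :
  morphism A C := Morphism (morphism_comp_subproof g f).

(* The internal versions of  h |-> h^X  and of  h |-> h^X r_A. *)
Definition ipow (X A B : V) : hom (B ^ A) ((B ^ X) ^ (A ^ X)) :=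
  curry (icomp X A B).
Definition rel_restrict (A B : structure) (R : symb L) :
  hom (B ^ A) ((B ^ arity R) ^ rel_ob A R) :=
  pre _ (rel A R) ∘ ipow (arity R) A B.

Definition Str_cone (A B : structure) : wcone (rel_restrict A B)
    (fun R => post (rel_ob A R) (rel B R)) := wide_pullback _ _.
Definition Str_hom (A B : structure) : V := wapex (Str_cone A B).
Definition Str_map (A B : structure) : hom (Str_hom A B) (B ^ A) :=
  wbase (Str_cone A B).
Definition Str_rel (A B : structure) (R : symb L) :
  hom (Str_hom A B) (rel_ob B R ^ rel_ob A R) := wleg (Str_cone A B) R.

(* The wide pullback condition, uncurried. *)
Definition compatible (A B : structure) (Z : V) (p : hom Z (B ^ A))
    (R : symb L) (q : hom Z (rel_ob B R ^ rel_ob A R)) : Prop :=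
  icomp (arity R) A B ∘ (p ⊗₁ rel A R) =
  rel B R ∘ ev _ _ ∘ (q ⊗₁ idm (rel_ob A R)).

Lemma compatibleP (A B : structure) (Z : V) (p : hom Z (B ^ A))
    (R : symb L) (q : hom Z (rel_ob B R ^ rel_ob A R)) :
  compatible p q <-> rel_restrict A B R ∘ p = post (rel_ob A R) (rel B R) ∘ q.
Proof.
have e : ev _ _ ∘ ((rel_restrict A B R ∘ p) ⊗₁ idm _) =
    icomp (arity R) A B ∘ (p ⊗₁ rel A R).
  rewrite -mcompA ev_pre -tensorm_lr tensormMl !mcompA ev_curry.
  by rewrite -mcompA tensorm_lr.
split=> [H|H]; first by apply: uncurry_inj; rewrite e ev_post H.
by rewrite /compatible -e H ev_post.
Qed.

Lemma Str_compatible (A B : structure) (R : symb L) :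
  compatible (Str_map A B) (Str_rel A B R).
Proof. by apply/compatibleP; apply: wcomm. Qed.

Lemma Str_map_mono (A B : structure) : mono (Str_map A B).
Proof.
move=> W u v e.
have er R : Str_rel A B R ∘ u = Str_rel A B R ∘ v.
  apply: (post_mono (proj2 (base_proper V) _ _ _ (rel_inM B R))).
  by rewrite !mcompA -!(wcomm (Str_cone A B)) -!mcompA e.
have c R : rel_restrict A B R ∘ (Str_map A B ∘ u) =
    post (rel_ob A R) (rel B R) ∘ (Str_rel A B R ∘ u).
  by rewrite !mcompA -(wcomm (Str_cone A B)).
have [h [_ Uh]] := wide_pullbackP (WCone c).
have <- : h = u by apply: Uh; split.
by apply: Uh; split=> [|R]; rewrite /= ?e ?er.
Qed.

Lemma Str_lift (A B : structure) (Z : V) (p : hom Z (B ^ A))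
    (q : forall R, hom Z (rel_ob B R ^ rel_ob A R)) :
  (forall R, compatible p (q R)) -> exists h : hom Z (Str_hom A B), Str_map A B ∘ h = p.
Proof.
move=> H; have c R := proj1 (compatibleP p (q R)) (H R).
by have [h [[Hh _] _]] := wide_pullbackP (WCone c); exists h.
Qed.

Lemma Str_id_exists (A : structure) :
  exists j : hom unit_ob (Str_hom A A), Str_map A A ∘ j = iid A.
Proof.
apply: (@Str_lift _ _ _ _ (fun R => iid (rel_ob A R))) => R.
rewrite /compatible -tensorm_lr mcompA icomp1m lunit_nat -[in RHS]mcompA.
by rewrite ev_curry.
Qed.

Lemma Str_comp_exists (A B C : structure) :
  exists m : hom (Str_hom B C ⊗ Str_hom A B) (Str_hom A C),
    Str_map A C ∘ m = icomp A B C ∘ (Str_map B C ⊗₁ Str_map A B).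
Proof.
apply: (@Str_lift _ _ _ _ (fun R => icomp _ (rel_ob B R) _ ∘
                            (Str_rel B C R ⊗₁ Str_rel A B R))) => R.
set p := Str_map B C; set p' := Str_map A B.
set q := Str_rel B C R; set q' := Str_rel A B R.
have HBC : _ = _ := Str_compatible B C R; have HAB : _ = _ := Str_compatible A B R.
rewrite -/p -/q in HBC; rewrite -/p' -/q' in HAB.
transitivity (icomp (arity R) B C ∘ (p ⊗₁ (icomp (arity R) A B ∘ (p' ⊗₁ rel A R)))
                ∘ assoc _ _ _).
  rewrite -[_ ⊗₁ rel A R]tensorm_lr tensormMl !mcompA icompA.
  rewrite -(mcompA _ (p ⊗₁ p' ⊗₁ _)) tensorm_lr -(mcompA _ (assoc _ _ _)) assoc_nat.
  by rewrite mcompA -(mcompA _ _ (p ⊗₁ _)) -tensormM mcomp1m.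
rewrite HAB -(mcompA (rel B R)) -[p]mcompm1 tensormM mcompA HBC.
rewrite -(mcompA _ (q ⊗₁ _)) tensorm_lr.
rewrite -[X in X ⊗₁ (ev _ _ ∘ _)]mcomp1m tensormM mcompA.
rewrite -(mcompA _ (q ⊗₁ _)) -assoc_nat !tensormMl !mcompA.
by rewrite -[in RHS](mcompA (rel C R)) ev_icomp !mcompA.
Qed.

Definition Str_id (A : structure) : hom unit_ob (Str_hom A A) :=
  sval (constructive_indefinite_description _ (Str_id_exists A)).
Definition Str_comp (A B C : structure) :
    hom (Str_hom B C ⊗ Str_hom A B) (Str_hom A C) :=
  sval (constructive_indefinite_description _ (Str_comp_exists A B C)).

Lemma Str_idE (A : structure) : Str_map A A ∘ Str_id A = iid A.
Proof. by rewrite /Str_id /Str_comp; case: (constructive_indefinite_description _ _). Qed.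
Lemma Str_compE (A B C : structure) :
  Str_map A C ∘ Str_comp A B C = icomp A B C ∘ (Str_map B C ⊗₁ Str_map A B).
Proof. by rewrite /Str_id /Str_comp; case: (constructive_indefinite_description _ _). Qed.

Lemma Str_comp1m (A B : structure) :
  Str_comp A B B ∘ (Str_id B ⊗₁ idm (Str_hom A B)) = lunit (Str_hom A B).
Proof.
apply: (@Str_map_mono A B); rewrite mcompA Str_compE -mcompA -tensormM Str_idE mcompm1.
by rewrite -tensorm_lr mcompA icomp1m lunit_nat.
Qed.

Lemma Str_compm1 (A B : structure) :
  Str_comp A A B ∘ (idm (Str_hom A B) ⊗₁ Str_id A) = runit (Str_hom A B).
Proof.
apply: (@Str_map_mono A B); rewrite mcompA Str_compE -mcompA -tensormM Str_idE mcompm1.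
by rewrite -tensorm_rl mcompA icompm1 runit_nat.
Qed.

Lemma Str_compA (A B C D : structure) :
  Str_comp A B D ∘ (Str_comp B C D ⊗₁ idm (Str_hom A B)) =
  Str_comp A C D ∘ (idm (Str_hom C D) ⊗₁ Str_comp A B C)
    ∘ assoc (Str_hom C D) (Str_hom B C) (Str_hom A B).
Proof.
apply: (@Str_map_mono A D); rewrite !mcompA !Str_compE.
rewrite -!(mcompA (icomp _ _ _)) -!tensormM !Str_compE !(mcompm1, mcomp1m).
rewrite -[X in _ = icomp _ _ _ ∘ (X ⊗₁ _ ∘ _)]mcomp1m tensormM.
rewrite -[X in icomp _ _ _ ∘ (_ ⊗₁ X) = _]mcomp1m tensormM.
by rewrite -[in RHS](mcompA (_ ⊗₁ _)) -assoc_nat !mcompA icompA.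
Qed.

Definition Str : Vcategory V := {|
  vob := structure;
  vhom := Str_hom;
  vid := Str_id;
  vcomp := Str_comp;
  vcomp1m := Str_comp1m;
  vcompm1 := Str_compm1;
  vcompA := Str_compA |}.

(* An (X,Y)-ary term is a map Y -> X, and [f_rel R Y t] is R^Y(t(z)). *)
Inductive formula : V -> Type :=
| f_eq (X Y : V) (s t : hom Y X) : formula X
| f_rel (R : symb L) (Y Z : V) (t : hom (arity R ⊗ Y) Z) : formula Z
| f_and (X : V) (J : U) (phi : J -> formula X) : formula X
| f_ex (X Y : V) (psi : formula (coprod X Y)) : formula X.

(* All arities occurring in phi are lambda-presentable and all its conjunctions
   have size < lambda; the arities of the symbols are covered by [lambda_ary]. *)
Fixpoint bounded (X : V) (phi : formula X) : Prop :=
  presentable lam X /\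
  match phi with
  | @f_eq X Y _ _ => presentable lam Y
  | @f_rel R Y Z _ => presentable lam Y
  | @f_and X J phi => card_lt J lam /\ forall j, bounded (phi j)
  | @f_ex X Y psi => presentable lam Y /\ bounded psi
  end.

Definition in_Llamlam (X : V) (phi : formula X) : Prop :=
  lambda_ary /\ bounded phi.

Record over (Z : V) := Over {
  over_ob : V;
  over_map : hom over_ob Z }.

Definition M_part (Y Z : V) (f : hom Y Z) : over Z := Over (fac_M (factor f)).

Definition pullback (X Y Z : V) (f : hom X Z) (g : hom Y Z) : over X :=
  Over (wbase (wide_pullback (fun _ : unit => f) (fun _ : unit => g))).

Definition intersection (Z : V) (J : U) (S : J -> over Z) : over Z :=
  Over (wbase (wide_pullback (fun _ : J => idm Z) (fun j => over_map (S j)))).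

(* Under  A^(X + Y) = A^X × A^Y  the first projection is  A^(inl). *)
Fixpoint interp (A : structure) (X : V) (phi : formula X) : over (A ^ X) :=
  match phi in formula X return over (A ^ X) with
  | @f_eq X Y s t => M_part (eleg (equalizer (pre A s) (pre A t)))
  | @f_rel R Y Z t =>
      pullback (pre A t) (uncurry2 (arity R) Y A ∘ post Y (rel A R))
  | @f_and X J phi => intersection (fun j => interp A (phi j))
  | @f_ex X Y psi => M_part (pre A (coprod_inl X Y) ∘ over_map (interp A psi))
  end.

Definition sat (A : structure) (X : V) (phi : formula X) (a : hom X A) : Prop :=
  exists u : hom unit_ob (over_ob (interp A phi)),
    over_map (interp A phi) ∘ u = transpose a.

(* Naturality is stated on the side of morphisms out of A, where it does not
   presuppose that satisfaction is preserved by morphisms. *)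
Definition presentation_formula (A : structure) (X : V) (pi : formula X) : Prop :=
  in_Llamlam pi /\
  exists Phi : forall B : structure, morphism A B -> {a : hom X B | sat pi a},
    (forall B, bijective (Phi B)) /\
    forall (B C : structure) (k : morphism B C) (h : morphism A B),
      sval (Phi C (morphism_comp k h)) = k ∘ sval (Phi B h).

End Structures.

Arguments f_eq {lam V L X Y} s t.
Arguments f_rel {lam V L} R Y {Z} t.
Arguments f_and {lam V L X J} phi.
Arguments f_ex {lam V L} X Y psi.

(* Main.v *)
From Corelib Require Import ssreflect ssrfun.
From Stdlib Require Import ClassicalEpsilon ProofIrrelevance FunctionalExtensionality.
Require Import Defs.

(** The arity of the presentation formula is the carrier of A, and the formula
    is a conjunction of atomic formulas; neither equations nor existential
    quantifiers occur in it.

    The carrier of a lambda-presentable structure is lambda-presentable in V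
    ([carrier_presentable]).  The forgetful functor has a right adjoint, sending
    B to the structure in which every relation is all of B^X.  As the arities
    X are lambda-presentable, powers by X preserve lambda-filtered
    colimits, hence so does this right adjoint ([indiscrete_conical]), and a left
    adjoint of such a functor preserves presentability.

    Each R_A is a colimit of lambda-presentable objects Y_i.  A map from A to B in
    V is a morphism of structures if and only if, for all R and i, the composite
    Y_i -> R_A -> A^X -> B^X factors through r_B: since r_B is a monomorphism,
    the factorizations on the Y_i glue.  Transposing Y_i -> A^X to a term
    t : X ⊗ Y_i -> A, this condition says that B satisfies R^(Y_i)(t)
    ([sat_rel]), so the conjunction of all these atomic formulas does what is
    required, except that there may be too many of them.

    To reduce their number, let A_S be the structure on the carrier of A whose
    relations are generated by a set S of fewer than lambda instances (R, i).
    These sets form a lambda-filtered poset and A is the enriched colimit of the A_S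
    ([generated_conical]).  By presentability the identity of A factors through
    some A_S -> A; as that map is the identity on carriers, the identity is a
    morphism from A to A_S.  So the morphisms out of A are those out of A_S, which
    are axiomatized by the instances in S alone ([few_instances_generate]). *)

Set Implicit Arguments.
Unset Strict Implicit.
Unset Printing Implicit Defensive.

Local Open Scope cat_scope.
#[local] Obligation Tactic := idtac.

(** * Cardinalities below a regular cardinal *)

Lemma sval_inj (T : Type) (P : T -> Prop) (x y : {t | P t}) : sval x = sval y -> x = y.
Proof. case: x y => x Px [y Py] /= e; subst y; f_equal; exact: proof_irrelevance. Qed.

Lemma card_lt_le (S T : U) (K : U) : card_le S T -> card_lt T K -> card_lt S K.
Proof.
move=> [f Hf] [[g Hg] N]; split.
  by exists (fun x => g (f x)) => x y /Hg /Hf.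
by move=> [h Hh]; apply: N; exists (fun x => f (h x)) => x y /Hf /Hh.
Qed.

Lemma card_le_surj (S T : U) (f : S -> T) : (forall t, exists s, f s = t) -> card_le T S.
Proof.
move=> Hf; pose g t := constructive_indefinite_description _ (Hf t).
by exists (fun t => sval (g t)) => x y e; rewrite -(proj2_sig (g x)) e (proj2_sig (g y)).
Qed.

Lemma card_lt_prop (lam : regular_cardinal) (S : U) : (forall x y : S, x = y) -> card_lt S lam.
Proof.
have [i Hi] := card_infinite lam; move=> HS; split.
  by exists (fun _ => i 0) => x y _; apply: HS.
move=> [f Hf]; have /Hf /Hi // : f (i 0) = f (i 1) by apply: HS.
Qed.

Section SmallSubsets.
Variables (lam : regular_cardinal) (T : U).

Record small_subset : U := SmallSubset {
  subset_mem :> T -> Prop;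
  subset_card : card_lt {x : T | subset_mem x} lam }.

Program Definition small_subsets : small_category :=
  {| sob := small_subset; shom := fun S S' => forall x : T, S x -> S' x;
     scat_laws := {| idm_ := fun S x Sx => Sx;
                     mcomp_ := fun S S' S'' g f x Sx => g x (f x Sx) |} |}.
Solve All Obligations with by move=> *; exact: proof_irrelevance.

Lemma singleton_card (t : T) : card_lt {x : T | x = t} lam.
Proof. by apply: card_lt_prop => -[x ex] [y ey]; apply: sval_inj; rewrite /= ex ey. Qed.

Lemma empty_card : card_lt {x : T | False} lam.
Proof. by apply: card_lt_prop => -[x []]. Qed.

Lemma union_card (K : U) (S : K -> small_subset) : card_lt K lam ->
  card_lt {x : T | exists k, S k x} lam.
Proof.
move=> HK; have HS := card_regular HK (fun k => subset_card (S k)).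
apply: card_lt_le HS.
pose f (p : {k : K & {x : T | S k x}}) : {x : T | exists k, S k x} :=
  exist _ (sval (projT2 p)) (ex_intro _ (projT1 p) (proj2_sig (projT2 p))).
apply: (@card_le_surj _ _ f) => -[x [k Hk]].
by exists (existT _ k (exist _ x Hk)); apply: sval_inj.
Qed.

(** Regularity of lambda is what makes the union of fewer than lambda small
    subsets small; the union is then the cocone. *)
Lemma small_subsets_filtered : filtered lam small_subsets.
Proof.
move=> K HK D.
have HO : card_lt (sob K) lam.
  apply: card_lt_le HK; exists (fun x => existT _ x (existT _ x (idm (x : K)))).
  by move=> x y e; exact: (f_equal (@projT1 _ _) e).
pose S (k : sob K) : small_subset := D (k : K).
pose c : ob small_subsets := SmallSubset (union_card S HO).
have l (k : K) : hom (D k) c by move=> x Hx; exists k.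
constructor; apply: (@Cocone _ _ D c l) => j k u.
exact: (@proof_irrelevance (forall x, S j x -> exists k, S k x)).
Qed.

End SmallSubsets.

(** * Colimits of sets *)

(** The image of the legs and the whole apex have characteristic functions that
    agree on every leg, so they coincide. *)
Lemma set_colimit_surj (J : category) (D : functor J sets) (c : cocone D) :
  is_colimit c -> forall x : apex c, exists j y, leg c j y = x.
Proof.
move=> Hc x; case: (classic (exists j y, leg c j y = x)) => // N.
pose f : hom (apex c) (bool : sets) := fun _ => true.
pose g : hom (apex c) (bool : sets) := fun z =>
  match excluded_middle_informative (exists j y, leg c j y = z) with
  | left _ => true
  | right _ => false
  end.
have e : f = g.
  apply: (colimit_epi Hc) => j; apply: functional_extensionality => y.
  rewrite /f /g /mcomp /=; case: excluded_middle_informative => // H.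
  by case: H; exists j, y.
have := f_equal (fun h => h x) e; rewrite /f /g.
by case: excluded_middle_informative.
Qed.

Lemma presentable_factor (lam : regular_cardinal) (C : category) (A : C) :
  presentable lam A -> forall J : small_category, filtered lam J ->
  forall (D : functor J C) (c : cocone D), is_colimit c ->
  forall a : hom A (apex c), exists j (b : hom A (D j)), leg c j ∘ b = a.
Proof. by move=> HA J HJ D c Hc a; exact: (set_colimit_surj (HA J HJ D c Hc) a). Qed.

(** * Maps of a closed category and their transposes *)

Section Transpose.
Variable V : smcc.

Definition untranspose (X A : V) (u : hom unit_ob (A ^ X)) : hom X A :=
  ev X A ∘ (u ⊗₁ idm X) ∘ lunit_inv X.

Lemma ev_transpose (X A : V) (a : hom X A) :
  ev X A ∘ (transpose a ⊗₁ idm X) = a ∘ lunit X.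
Proof. by rewrite ev_curry. Qed.

Lemma transposeK (X A : V) (a : hom X A) : untranspose (transpose a) = a.
Proof. by rewrite /untranspose ev_transpose -mcompA lunit_invK mcompm1. Qed.

Lemma untransposeK (X A : V) (u : hom unit_ob (A ^ X)) : transpose (untranspose u) = u.
Proof.
by apply: uncurry_inj; rewrite ev_transpose /untranspose -!mcompA lunitK mcompm1.
Qed.

Lemma transpose_inj (X A : V) (a b : hom X A) : transpose a = transpose b -> a = b.
Proof. by move=> e; rewrite -[a]transposeK e transposeK. Qed.

Lemma post1 (X A : V) : post X (idm A) = idm (A ^ X).
Proof. by apply: uncurry_inj; rewrite /post ev_curry tensorm1 mcomp1m mcompm1. Qed.

Lemma post_transpose (X A B : V) (f : hom A B) (a : hom X A) :
  post X f ∘ transpose a = transpose (f ∘ a).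
Proof. by apply: uncurry_inj; rewrite ev_post -mcompA !ev_transpose mcompA. Qed.

Lemma pre_transpose (X Y A : V) (f : hom X Y) (a : hom Y A) :
  pre A f ∘ transpose a = transpose (a ∘ f).
Proof.
apply: uncurry_inj.
by rewrite ev_pre -tensorm_lr mcompA !ev_transpose -mcompA lunit_nat mcompA.
Qed.

Lemma transpose1 (X : V) : transpose (idm X) = iid X.
Proof. by rewrite /transpose mcomp1m. Qed.

Lemma ev_icomp_tensor (W T A B C : V) (p : hom W (C ^ B)) (q : hom T (B ^ A)) :
  ev A C ∘ ((icomp A B C ∘ (p ⊗₁ q)) ⊗₁ idm A) =
  ev B C ∘ (p ⊗₁ (ev A B ∘ (q ⊗₁ idm A))) ∘ assoc W T A.
Proof.
rewrite tensormMl mcompA ev_icomp -mcompA assoc_nat mcompA -(mcompA (ev B C)).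
by rewrite -tensormM mcomp1m.
Qed.

Lemma icomp_transposel (W A B C : V) (g : hom B C) (q : hom W (B ^ A)) :
  icomp A B C ∘ (transpose g ⊗₁ q) = post A g ∘ q ∘ lunit W.
Proof.
apply: uncurry_inj; rewrite ev_icomp_tensor -(mcompA (post A g)) ev_post.
rewrite -(tensorm_lr (transpose g)) mcompA ev_transpose -(mcompA g) lunit_nat.
by rewrite -!mcompA lunit_tensor -tensormMl.
Qed.

Lemma icomp_transposer (W A B C : V) (f : hom A B) (p : hom W (C ^ B)) :
  icomp A B C ∘ (p ⊗₁ transpose f) = pre C f ∘ p ∘ runit W.
Proof.
apply: uncurry_inj; rewrite ev_icomp_tensor -(mcompA (pre C f)) ev_pre ev_transpose.
rewrite -[p in LHS]mcompm1 tensormM -!mcompA triangle -tensormM.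
by rewrite mcompm1.
Qed.

(** Dinaturality of composition in the middle object: f can act on either of the
    two factors. *)
Lemma icomp_dinatural (W A B B' C : V) (p : hom W (C ^ B')) (f : hom B B') :
  icomp A B' C ∘ (p ⊗₁ post A f) = icomp A B C ∘ ((pre C f ∘ p) ⊗₁ idm (B ^ A)).
Proof.
apply: uncurry_inj; rewrite !ev_icomp_tensor tensorm1 mcompm1; f_equal.
rewrite -(tensorm_lr (pre C f ∘ p)) mcompA ev_pre -mcompA -tensormM mcompm1.
by rewrite /post ev_curry.
Qed.

(** Exchanging the two variables turns maps into a power of A, contravariant in
    the exponent, into maps out of the exponent, so that colimits in the exponent
    become applicable. *)
Definition swap (X Y A : V) (p : hom X (A ^ Y)) : hom Y (A ^ X) :=
  curry (ev Y A ∘ (p ⊗₁ idm Y) ∘ braid Y X).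

Lemma swapK (X Y A : V) (p : hom X (A ^ Y)) : swap (swap p) = p.
Proof.
by apply: uncurry_inj; rewrite /swap !ev_curry -mcompA braidK mcompm1.
Qed.

Lemma swap_pre (X Y Z A : V) (p : hom X (A ^ Y)) (f : hom Z Y) :
  swap (pre A f ∘ p) = swap p ∘ f.
Proof.
rewrite /swap ev_pre curry_comp -[in RHS]mcompA braid_nat mcompA.
by rewrite -[in RHS](mcompA (ev Y A)) tensorm_lr.
Qed.

(** The interpretation of R^Y(t) involves (A^X)^Y and A^(X ⊗ Y); on elements the
    isomorphism between them is the usual transposition, and this is how
    satisfaction of an atomic formula is reduced to a factorization in V. *)
Lemma uncurry2_transpose (X Y A : V) (w : hom Y (A ^ X)) :
  uncurry2 X Y A ∘ transpose w = transpose (ev X A ∘ (w ⊗₁ idm X) ∘ braid X Y).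
Proof.
rewrite /uncurry2 curry_comp; congr curry.
rewrite -!mcompA tensorm_rl -[transpose w]mcompm1 -[braid X Y]mcomp1m tensormM.
rewrite (mcompA (assoc_inv _ _ _)).
have -> : assoc_inv _ _ _ ∘ (transpose w ⊗₁ idm (Y ⊗ X)) =
    (transpose w ⊗₁ idm Y ⊗₁ idm X) ∘ assoc_inv _ _ _.
  rewrite -[LHS]mcompm1 -(assoc_invK unit_ob) -!mcompA (mcompA (_ ⊗₁ idm _)).
  by rewrite -tensorm1 -assoc_nat !mcompA assocK mcomp1m.
rewrite -mcompA (mcompA (ev Y _ ⊗₁ _)) -tensormMl ev_transpose tensormMl.
rewrite -lunit_tensor mcomp1m -!mcompA (mcompA (assoc _ _ _)) assoc_invK mcomp1m.
by rewrite lunit_nat.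
Qed.

End Transpose.

(** * Families that detect factorizations through monomorphisms *)

Definition factors (C : category) (T X Y : C) (m : hom X Y) (f : hom T Y) : Prop :=
  exists g, m ∘ g = f.

Lemma factors_comp (C : category) (S T X Y : C) (m : hom X Y) (f : hom T Y) (k : hom S T) :
  factors m f -> factors m (f ∘ k).
Proof. by move=> [g <-]; exists (g ∘ k); rewrite mcompA. Qed.

(** A jointly strongly epimorphic family, reduced to the property needed to
    verify that a map respects relations.  No compatibility between the
    factorizations on the members is asked for: m being a monomorphism forces it. *)
Definition covers (C : category) (T : C) (J : U) (Y : J -> C) (y : forall j, hom (Y j) T) :=
  forall (X Z : C) (m : hom X Z) (f : hom T Z),
    mono m -> (forall j, factors m (f ∘ y j)) -> factors m f.

Lemma colimit_covers (J : small_category) (C : category) (D : functor J C) (c : cocone D) :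
  is_colimit c -> covers (fun j : sob J => leg c (j : J)).
Proof.
move=> Hc X Z m f Hm H.
pose g j := constructive_indefinite_description _ (H j).
have N (j k : J) (u : hom j k) : sval (g k) ∘ fmap D u = sval (g j).
  by apply: Hm; rewrite mcompA !(proj2_sig (g _)) -mcompA leg_nat.
have [h [Hh _]] := Hc (Cocone N).
exists h; apply: (colimit_epi Hc) => j.
by rewrite -mcompA Hh /= (proj2_sig (g j)).
Qed.

Lemma covers_refine (C : category) (T : C) (J K : U) (Y : J -> C) (Y' : K -> C)
    (y : forall j, hom (Y j) T) (y' : forall k, hom (Y' k) T) :
  (forall j, exists k, factors (y' k) (y j)) -> covers y -> covers y'.
Proof.
move=> Hy Hc X Z m f Hm H; apply: Hc => // j.
have [k [g <-]] := Hy j; rewrite mcompA; exact: factors_comp.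
Qed.

(** Closedness of V makes the property stable under Z ⊗ -, which is needed
    because homs of structures are objects of V. *)
Lemma covers_tensor (V : smcc) (T : V) (J : U) (Y : J -> V) (y : forall j, hom (Y j) T) :
  covers y -> forall (Z X S : V) (m : hom X S) (f : hom (Z ⊗ T) S), mono m ->
  (forall j, factors m (f ∘ (idm Z ⊗₁ y j))) -> factors m f.
Proof.
move=> Hy Z X S m f Hm H.
have [g Hg] : factors (post Z m) (curry (f ∘ braid T Z)).
  apply: Hy; first exact: post_mono.
  move=> j; have [h Hh] := H j; exists (curry (h ∘ braid (Y j) Z)).
  rewrite curry_comp -(mcompA f) braid_nat mcompA -Hh.
  by apply: uncurry_inj; rewrite ev_post -mcompA !ev_curry mcompA.
exists (ev Z X ∘ (g ⊗₁ idm Z) ∘ braid Z T).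
rewrite !mcompA -ev_post Hg ev_curry -mcompA braidK.
exact: mcompm1.
Qed.

Section Base.
Variables (lam : regular_cardinal) (V : base lam).

(** In a locally presentable category every object is a colimit of presentable
    ones, and colimits are covered by their legs. *)
Lemma presentable_covers (T : V) : exists (J : U) (Y : J -> V) (y : forall j, hom (Y j) T),
  (forall j, presentable lam (Y j)) /\ covers y.
Proof.
have [[_ [I [G [HG H]]]] _] := base_lp V.
have [J [D [c [_ [HD [Hc eT]]]]]] := H T; subst T.
exists (sob J), (fun j => D (j : J)), (fun j => leg c (j : J)); split.
  by move=> j; have [i ->] := HD j.
exact: colimit_covers.
Qed.

(** Powers by X preserve the filtered colimit, but the covering property is
    enough: a map G -> (colim D)^X with G presentable transposes to G ⊗ X -> colim D,
    which factors through a leg since G ⊗ X is presentable. *)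
Lemma cover_post (X : V) : presentable lam X ->
  forall J : small_category, filtered lam J ->
  forall (D : functor J V) (c : cocone D), is_colimit c ->
  covers (fun j : sob J => post X (leg c (j : J))).
Proof.
move=> HX J HJ D c Hc.
have [I [Y [y [HY Hy]]]] := presentable_covers (apex c ^ X).
apply: covers_refine Hy => i.
have HYX : presentable lam (Y i ⊗ X) by apply: (proj2 (proj2 (base_lp V))).
have [j [b Hb]] := presentable_factor HYX HJ Hc (ev X _ ∘ (y i ⊗₁ idm X)).
exists j, (curry b); apply: uncurry_inj.
by rewrite ev_post -mcompA ev_curry.
Qed.

Program Definition discrete (J : U) : small_category :=
  {| sob := J; shom := fun a b => a = b;
     scat_laws := {|
       idm_ := fun a => erefl;
       mcomp_ := fun a b c (g : b = c) (f : a = b) => etrans f g |} |}.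
Solve All Obligations with by move=> *; exact: proof_irrelevance.

Program Definition discrete_functor (C : category) (J : U) (Y : J -> C) :
    functor (discrete J) C :=
  {| fob := Y : discrete J -> C;
     fmap := fun (a b : J) (u : a = b) =>
       match u in _ = c return hom (Y a) (Y c) with erefl => idm _ end |}.
Next Obligation. by []. Qed.
Next Obligation.
move=> C J Y a b c; rewrite /hom /= => g f; subst c b => /=.
by rewrite mcomp1m.
Qed.

(** The smallest M-subobject containing a family of maps is the image of the map
    that they define on the coproduct. *)
Lemma image_of_family (T : V) (J : U) (Y : J -> V) (y : forall j, hom (Y j) T) :
  exists w : over T, clsM (over_map w) /\ (forall j, factors (over_map w) (y j)) /\
  forall (X S : V) (n : hom X S) (g : hom T S), clsM n ->
    (forall j, factors n (g ∘ y j)) -> factors n (g ∘ over_map w).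
Proof.
have [c Hc] := proj1 (proj1 (base_lp V)) (discrete J) (discrete_functor Y).
have copair (S : V) (z : forall j, hom (Y j) S) :
    exists f : hom (apex c) S, forall j, f ∘ leg c (j : discrete J) = z j.
  have N (j k : discrete J) (u : hom j k) : z k ∘ fmap (discrete_functor Y) u = z j.
    by move: k u => k; rewrite /hom /= => u; subst k; rewrite /= mcompm1.
  by have [f [Hf _]] := Hc (Cocone N); exists f.
have [f Hf] := copair T y.
case: (factor f) => W e m eE mM ef.
exists (Over m); split=> //; split=> [j|X S n g nM H].
  by exists (e ∘ leg c (j : discrete J)); rewrite mcompA ef Hf.
pose k j := constructive_indefinite_description _ (H j).
have [h Hh] := copair X (fun j => sval (k j)).
have sq : n ∘ h = g ∘ m ∘ e.
  rewrite -mcompA ef; apply: (colimit_epi Hc) => j.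
  by rewrite -!mcompA Hh Hf (proj2_sig (k j)).
have [d [[_ Hd] _]] := proj1 (ofs_E (proj1 (base_fs V)) e) eE _ _ n nM _ _ sq.
by exists d.
Qed.

Lemma idm_inM (X : V) : clsM (idm X).
Proof.
apply/(ofs_M (proj1 (base_fs V))) => A B e _ u v; rewrite mcomp1m => euv.
by exists v; split=> [|d [_ <-]]; rewrite mcomp1m.
Qed.

Lemma clsM_mono (X Y : V) (m : hom X Y) : clsM m -> mono m.
Proof. exact: (proj2 (base_proper V)). Qed.

(** * The ordinary category of structures *)

Section Structures.
Variable L : language V.

(** A map into the hom-object of structures is a map into the internal hom with a
    property, so that all equations between such maps can be verified after
    [Str_map]. *)
Lemma Str_liftP (A B : structure L) (Z : V) (p : hom Z (B ^ A)) :
  (exists h : hom Z (Str_hom A B), Str_map A B ∘ h = p) <->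
  forall R, factors (rel B R) (icomp (arity R) A B ∘ (p ⊗₁ rel A R)).
Proof.
split=> [[h <-] R|H].
  exists (ev _ _ ∘ (Str_rel A B R ⊗₁ idm _) ∘ (h ⊗₁ idm _)).
  have e : _ = _ := Str_compatible A B R.
  by rewrite !mcompA -e -mcompA -tensormM mcompm1.
pose q R := constructive_indefinite_description _ (H R).
apply: (@Str_lift _ _ _ _ _ _ _ (fun R => curry (sval (q R)))) => R.
by rewrite /compatible -[in RHS]mcompA ev_curry (proj2_sig (q R)).
Qed.

(** The morphisms of the underlying category of [Str L] are elements of
    hom-objects; [carr] and [elt] translate between these and maps of V that
    respect the relations. *)
Definition carr (A B : structure L) (k : hom unit_ob (Str_hom A B)) : hom A B :=
  untranspose (Str_map A B ∘ k).

Lemma Str_map_elt (A B : structure L) (k : hom unit_ob (Str_hom A B)) :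
  Str_map A B ∘ k = transpose (carr k).
Proof. by rewrite /carr untransposeK. Qed.

Lemma carr_inj (A B : structure L) (k l : hom unit_ob (Str_hom A B)) :
  carr k = carr l -> k = l.
Proof. by move=> e; apply: (@Str_map_mono _ _ _ A B); rewrite !Str_map_elt e. Qed.

Lemma is_morphismP (A B : structure L) (h : hom A B) :
  is_morphism h <-> exists k : hom unit_ob (Str_hom A B), carr k = h.
Proof.
have E : (exists k : hom unit_ob (Str_hom A B), carr k = h) <->
    exists k, Str_map A B ∘ k = transpose h.
  split=> -[k Hk]; exists k; first by rewrite Str_map_elt Hk.
  by apply: transpose_inj; rewrite -Str_map_elt.
apply: iff_trans (iff_sym E); apply: iff_trans (iff_sym (Str_liftP _)).
split=> H R; have [g Hg] := H R.
  by exists (g ∘ lunit _); rewrite icomp_transposel mcompA Hg.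
exists (g ∘ lunit_inv _).
by rewrite mcompA Hg icomp_transposel -!mcompA lunit_invK mcompm1.
Qed.

Lemma elt_exists (A B : structure L) (h : morphism A B) :
  exists k : hom unit_ob (Str_hom A B), carr k = h.
Proof. by apply/is_morphismP; exact: morP. Qed.

Definition elt (A B : structure L) (h : morphism A B) : hom unit_ob (Str_hom A B) :=
  sval (constructive_indefinite_description _ (elt_exists h)).

Lemma carr_elt (A B : structure L) (h : morphism A B) : carr (elt h) = h.
Proof. exact: (proj2_sig (constructive_indefinite_description _ (elt_exists h))). Qed.

Lemma carr_id (A : structure L) : carr (Str_id A) = idm A.
Proof. by apply: transpose_inj; rewrite -Str_map_elt Str_idE transpose1. Qed.

Lemma carr_comp (A B C : Str L) (g : hom unit_ob (vhom B C)) (f : hom unit_ob (vhom A B)) :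
  carr (under_comp g f) = carr g ∘ carr f.
Proof.
apply: transpose_inj; rewrite -Str_map_elt /under_comp 2!mcompA Str_compE.
rewrite -(mcompA (icomp _ _ _)) -tensormM !Str_map_elt icomp_transposel.
by rewrite -mcompA lunit_invK mcompm1 post_transpose.
Qed.

Lemma Str_map_vpre (A B C : Str L) (f : hom unit_ob (vhom A B)) :
  Str_map A C ∘ vpre C f = pre (carrier C) (carr f) ∘ Str_map B C.
Proof.
rewrite /vpre !mcompA Str_compE -(mcompA (icomp _ _ _)) -tensormM mcompm1 Str_map_elt.
by rewrite icomp_transposer -!mcompA runit_invK mcompm1.
Qed.


(** * Filtered colimits of structures *)

(** A criterion for colimits of structures.  A compatible family of maps respecting
    the relations of the diagram induces a map on the colimit of the carriers;
    on the pieces that cover a relation of the apex its composite factors through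
    the monomorphism r_B, and these factorizations glue. *)
Lemma conical_colimit_of_covers (J : small_category)
    (D : functor J (underlying (Str L))) (c : cocone D) :
  (forall (W : V) (w : forall j, hom (carrier (D j)) W),
    (forall j k (u : hom j k), w k ∘ carr (fmap D u) = w j) ->
    exists! f : hom (carrier (apex c)) W, forall j, f ∘ carr (leg c j) = w j) ->
  (forall R, exists (I : U) (Y : I -> V) (y : forall i, hom (Y i) (rel_ob (apex c) R)),
    covers y /\ forall i, exists j,
      factors (post (arity R) (carr (leg c j)) ∘ rel (D j) R) (rel (apex c) R ∘ y i)) ->
  conical_colimit c.
Proof.
move=> Hcar Hrel B Z z Hz.
pose p j : hom Z (carrier B ^ carrier (D j)) := Str_map (D j) B ∘ z j.
(* The maps Z -> B^(D j) are glued as maps D j -> B^Z. *)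
have [|f [Hf Uf]] := Hcar (carrier B ^ Z) (fun j => swap (p j)).
  move=> j k u; rewrite -swap_pre /p mcompA -(Str_map_vpre B (fmap D u)).
  by rewrite -(Hz j k u) !mcompA.
have Hp j : pre (carrier B) (carr (leg c j)) ∘ swap f = p j.
  by rewrite -[LHS]swapK swap_pre swapK Hf swapK.
have [h Hh] : exists h : hom Z (Str_hom (apex c) B), Str_map (apex c) B ∘ h = swap f.
  apply/Str_liftP => R; have [I [Y [y [Hy Hyj]]]] := Hrel R.
  apply: (covers_tensor Hy) => [|i]; first exact: clsM_mono (rel_inM B R).
  have [j [g Hg]] := Hyj i.
  rewrite -mcompA -tensormM mcompm1 -Hg -mcompA -[swap f]mcompm1 tensormM mcompA icomp_dinatural Hp.
  rewrite -mcompA tensorm_lr -[p j]mcompm1 tensormM mcompA; apply: factors_comp.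
  by apply: (proj1 (Str_liftP (p j))); exists (z j).
exists h; split=> [j|h' Hh'].
  apply: (@Str_map_mono _ _ _ (D j) B).
  by rewrite mcompA (Str_map_vpre B (leg c j)) -mcompA Hh Hp.
apply: (@Str_map_mono _ _ _ (apex c) B); rewrite Hh -[RHS]swapK; congr swap.
apply: Uf => j; rewrite -swap_pre mcompA -(Str_map_vpre B (leg c j)) -mcompA.
by rewrite Hh'.
Qed.

(** The value at B of the right adjoint of the forgetful functor. *)
Definition indiscrete (B : V) : structure L :=
  Structure (fun R : symb L => idm_inM (B ^ arity R)).

Lemma indiscrete_morphism (A : structure L) (B : V) (h : hom A B) :
  is_morphism (h : hom A (indiscrete B)).
Proof. by move=> R; exists (post (arity R) h ∘ rel A R); rewrite mcomp1m. Qed.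

Definition indiscrete_elt (A : structure L) (B : V) (h : hom A B) :
  hom unit_ob (Str_hom A (indiscrete B)) := elt (Morphism (indiscrete_morphism h)).

Lemma carr_indiscrete_elt (A : structure L) (B : V) (h : hom A B) :
  carr (indiscrete_elt h) = h.
Proof. exact: carr_elt. Qed.

Program Definition indiscrete_functor : functor V (underlying (Str L)) :=
  {| fob := indiscrete : V -> underlying (Str L);
     fmap := fun X Y f => @indiscrete_elt (indiscrete X) Y f |}.
Next Obligation.
by move=> X; apply: carr_inj; rewrite carr_indiscrete_elt [RHS]carr_id.
Qed.
Next Obligation.
move=> X Y Z g f; apply: carr_inj.
by rewrite [RHS]carr_comp !carr_indiscrete_elt.
Qed.

Lemma indiscrete_conical (HL : lambda_ary L) (J : small_category) (HJ : filtered lam J)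
    (D : functor J V) (c : cocone D) :
  is_colimit c -> conical_colimit (map_cocone indiscrete_functor c).
Proof.
move=> Hc; apply: conical_colimit_of_covers => [W w Hw|R].
  have N j k (u : hom j k) : w k ∘ fmap D u = w j.
    by rewrite -(Hw j k u) /= carr_indiscrete_elt.
  have [f [Hf Uf]] := Hc (Cocone N); exists f; split=> [j|g Hg].
    by rewrite /= carr_indiscrete_elt; exact: Hf.
  by apply: Uf => j; have := Hg j; rewrite /= carr_indiscrete_elt.
exists (sob J), (fun j => D (j : J) ^ arity R), (fun j => post (arity R) (leg c (j : J))).
split; first exact: (cover_post (HL R) HJ Hc).
move=> j; exists j, (idm _); rewrite /= carr_indiscrete_elt.
by rewrite !mcompm1 mcomp1m.
Qed.

(** Elements of the hom-object from A to the indiscrete structure on B are the maps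
    A -> B of V, and taking elements preserves lambda-filtered colimits because the
    unit is lambda-presentable. *)
Lemma carrier_presentable (HL : lambda_ary L) (A : structure L) :
  vpresentable lam (A : Str L) -> presentable lam (carrier A).
Proof.
move=> HA J HJ D c Hc c'.
have H := proj1 (proj2 (base_lp V)) J HJ _ _ (HA J HJ _ _ (indiscrete_conical HL HJ Hc)).
pose n j (x : hom unit_ob (Str_hom A (indiscrete (D j)))) : apex c' := leg c' j (carr x).
have fmapE (X Y : V) (f : hom X Y) (x : hom unit_ob (Str_hom A (indiscrete X))) :
    carr (vpost (A : Str L) (@indiscrete_elt (indiscrete X) Y f) ∘ x
            : hom unit_ob (Str_hom A (indiscrete Y))) = f ∘ carr x.
  by rewrite -(under_compE (K := Str L)) carr_comp carr_indiscrete_elt.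
have N j k (u : hom j k) : (fun x => n k (fmap (vhom_functor (A : Str L))
    (fmap indiscrete_functor (fmap D u)) ∘ x)) = n j.
  apply: functional_extensionality => x; rewrite /n /= fmapE.
  exact: (f_equal (fun g => g (carr x)) (leg_nat c' u)).
pose D' := comp_functor (hom_set (unit_ob : V))
  (comp_functor (vhom_functor (A : Str L)) (comp_functor indiscrete_functor D)).
have [F [HF UF]] := H (@Cocone _ _ D' (apex c') n N).
exists (fun a => F (indiscrete_elt a)); split=> [j|G HG].
  apply: functional_extensionality => a.
  have := f_equal (fun g => g (indiscrete_elt a)) (HF j).
  rewrite /n /= carr_indiscrete_elt => <-; congr F.
  by apply: carr_inj; rewrite [RHS]fmapE !carr_indiscrete_elt.
have e : F = fun x => G (carr x).
  apply: UF => j; apply: functional_extensionality => x.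
  apply: etrans (f_equal (fun g => g (carr x)) (HG j)).
  exact: (f_equal G (fmapE _ _ _ x)).
by apply: functional_extensionality => a; rewrite e carr_indiscrete_elt.
Qed.

(** * Structures generated by few relation instances *)

Section Generated.
Variables (A : structure L) (I : symb L -> U) (Y : forall R, I R -> V).
Variable y : forall R (i : I R), hom (Y i) (rel_ob A R).
Hypothesis Hy : forall R, covers (@y R).

(** Pairs of a relation symbol and a member of the cover of its relation: each of
    them contributes one atomic formula. *)
Definition instance : U := {R : symb L & I R}.

Definition inst (R : symb L) (i : I R) : hom (Y i) (A ^ arity R) := rel A R ∘ y i.

Definition preserves (S : instance -> Prop) (B : structure L) (h : hom A B) : Prop :=
  forall R (i : I R), S (existT _ R i) -> factors (rel B R) (post (arity R) h ∘ inst i).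

Definition generated_rel (S : instance -> Prop) (R : symb L) : over (A ^ arity R) :=
  sval (constructive_indefinite_description _ (image_of_family
    (fun i : {i : I R | S (existT _ R i)} => inst (sval i)))).

Lemma generated_relP (S : instance -> Prop) (R : symb L) :
  clsM (over_map (generated_rel S R)) /\
  (forall i, S (existT _ R i) -> factors (over_map (generated_rel S R)) (inst i)) /\
  forall (X Z : V) (n : hom X Z) (g : hom (A ^ arity R) Z), clsM n ->
    (forall i, S (existT _ R i) -> factors n (g ∘ inst i)) ->
    factors n (g ∘ over_map (generated_rel S R)).
Proof.
rewrite /generated_rel; case: constructive_indefinite_description => w [Hw [H1 H2]] /=.
split=> //; split=> [i Hi|X Z n g Hn H]; first exact: (H1 (exist _ i Hi)).
by apply: H2 => // -[i Hi]; exact: H.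
Qed.

Definition generated (S : instance -> Prop) : structure L :=
  Structure (fun R => proj1 (generated_relP S R)).

(** The relations of [generated S] are images, and r_B is in M, so orthogonality
    reduces respecting them to respecting the generating instances. *)
Lemma generated_morphismP (S : instance -> Prop) (B : structure L) (h : hom A B) :
  is_morphism (h : hom (generated S) B) <-> preserves S h.
Proof.
split=> [H R i Hi|H R].
  have [hR e] := H R; have [g Hg] := proj1 (proj2 (generated_relP S R)) i Hi.
  by exists (hR ∘ g); rewrite /= mcompA e -mcompA Hg.
apply: (proj2 (proj2 (generated_relP S R))); first exact: rel_inM.
by move=> i Hi; exact: H.
Qed.

Lemma morphism_preserves (S : instance -> Prop) (B : structure L) (h : hom A B) :
  is_morphism h -> preserves S h.
Proof.
move=> H R i _; have [hR e] := H R.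
by exists (hR ∘ y i); rewrite mcompA e mcompA.
Qed.

Lemma generated_incl (S S' : instance -> Prop) : (forall t, S t -> S' t) ->
  is_morphism (idm A : hom (generated S) (generated S')).
Proof.
move=> HS; apply/generated_morphismP => R i /HS Hi; rewrite post1 mcomp1m.
exact: (proj1 (proj2 (generated_relP S' R)) i Hi).
Qed.

Lemma generated_to (S : instance -> Prop) : is_morphism (idm A : hom (generated S) A).
Proof.
apply/generated_morphismP; apply: morphism_preserves.
by move=> R; exists (idm _); rewrite post1 mcomp1m mcompm1.
Qed.

Program Definition generated_functor :
    functor (small_subsets lam instance) (underlying (Str L)) :=
  {| fob := fun S : small_subsets lam instance =>
       generated (S : small_subset lam instance) : underlying (Str L);
     fmap := fun S S' HS => elt (Morphism (generated_incl HS)) |}.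
Next Obligation.
by move=> S; apply: carr_inj; rewrite carr_elt [RHS]carr_id.
Qed.
Next Obligation.
by move=> S S' S'' g f; apply: carr_inj; rewrite [RHS]carr_comp !carr_elt /= mcomp1m.
Qed.

Program Definition generated_cocone : cocone generated_functor :=
  {| apex := A : underlying (Str L);
     leg := fun S => elt (Morphism (generated_to (S : small_subset lam instance))) |}.
Next Obligation.
by move=> S S' u; apply: carr_inj; rewrite [LHS]carr_comp !carr_elt /= mcomp1m.
Qed.

(** All structures in the diagram have the same carrier and all transition maps are
    identities; since there is a least small subset, the carriers have
    colimit A.  Singletons suffice to cover the relations of A. *)
Lemma generated_conical : conical_colimit generated_cocone.
Proof.
pose none : small_subsets lam instance := SmallSubset (empty_card lam instance).
apply: conical_colimit_of_covers => [W w Hw|R].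
  exists (w none); split=> [S|f Hf].
    rewrite /= carr_elt /= mcompm1.
    have u : hom none S by move=> t [].
    by have := Hw none S u; rewrite /= carr_elt /= mcompm1.
  by have := Hf none; rewrite /= carr_elt /= mcompm1.
exists (I R), (@Y R), (@y R); split; first exact: Hy.
move=> i; pose t : instance := existT _ R i.
pose S : small_subset lam instance := SmallSubset (singleton_card lam t).
have [g Hg] := proj1 (proj2 (generated_relP S R)) i (erefl t).
exists (S : small_subsets lam instance), g.
by rewrite /= carr_elt /= post1 mcomp1m Hg.
Qed.

Lemma few_instances_generate : vpresentable lam (A : Str L) ->
  exists S : small_subset lam instance,
  forall (B : structure L) (h : hom A B), is_morphism h <-> preserves S h.
Proof.
move=> HA.
have H := HA _ (@small_subsets_filtered lam instance) _ _ generated_conical.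
(* k is an element of the hom-object from A to generated S lifting the identity. *)
have [S [k Hk]] := presentable_factor (proj1 (proj2 (base_lp V)))
  (@small_subsets_filtered lam instance) H (Str_id A).
have ek : carr k = idm A.
  have e : carr (under_comp (K := Str L) (leg generated_cocone S) k) = carr (Str_id A).
    by rewrite (under_compE (K := Str L)); congr carr.
  by move: e; rewrite carr_comp carr_id /= carr_elt /= mcomp1m.
have idS : is_morphism (idm A : hom A (generated (S : small_subset lam instance))).
  by apply/is_morphismP; exists k.
exists S => B h; split; first exact: morphism_preserves.
move/generated_morphismP => Hh.
have := morphism_comp_subproof (Morphism Hh) (Morphism idS).
by rewrite /= mcompm1.
Qed.

End Generated.

(** * Satisfaction *)

Lemma pullback_factors (X W Z T : V) (f : hom X Z) (g : hom W Z) (u : hom T X) :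
  factors (over_map (pullback f g)) u <-> factors g (f ∘ u).
Proof.
rewrite /pullback; set w := wide_pullback _ _; split=> [[v <-]|[v Hv]].
  by exists (wleg w tt ∘ v); rewrite !mcompA (wcomm w tt).
have N (j : unit) : f ∘ u = g ∘ v by rewrite Hv.
have [h [[Hh _] _]] := wide_pullbackP (WCone (f := fun _ => f) (g := fun _ => g)
  (wleg := fun _ => v) N).
by exists h.
Qed.

Lemma intersection_factors (Z : V) (J : U) (S : J -> over Z) (T : V) (u : hom T Z) :
  factors (over_map (intersection S)) u <-> forall j, factors (over_map (S j)) u.
Proof.
rewrite /intersection; set w := wide_pullback _ _; split=> [[v <-] j|H].
  by exists (wleg w j ∘ v); rewrite mcompA -(wcomm w j) mcomp1m.
pose v j := constructive_indefinite_description _ (H j).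
have N j : idm Z ∘ u = over_map (S j) ∘ sval (v j).
  by rewrite mcomp1m (proj2_sig (v j)).
have [h [[Hh _] _]] := wide_pullbackP (WCone (f := fun _ => idm Z)
  (g := fun j => over_map (S j)) (wleg := fun j => sval (v j)) N).
by exists h.
Qed.

Lemma sat_and (X : V) (J : U) (phi : J -> formula L X) (B : structure L) (a : hom X B) :
  sat (f_and phi) a <-> forall j, sat (phi j) a.
Proof. exact: intersection_factors. Qed.

(** The term that names a family w of maps X -> A indexed by Y. *)
Definition family_term (X Y A : V) (w : hom Y (A ^ X)) : hom (X ⊗ Y) A :=
  ev X A ∘ (w ⊗₁ idm X) ∘ braid X Y.

Lemma family_term_inj (X Y A : V) (w w' : hom Y (A ^ X)) :
  family_term w = family_term w' -> w = w'.
Proof.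
move=> e; apply: uncurry_inj.
have := f_equal (fun h => h ∘ braid Y X) e.
by rewrite /family_term /= -!mcompA braidK mcompm1 => /= ->; rewrite mcompm1.
Qed.

Lemma sat_rel (R : symb L) (Y X : V) (w : hom Y (X ^ arity R)) (B : structure L)
    (a : hom X B) :
  sat (f_rel R Y (family_term w)) a <-> factors (rel B R) (post (arity R) a ∘ w).
Proof.
apply: iff_trans (pullback_factors _ _ _) _.
rewrite pre_transpose.
have -> : a ∘ family_term w = family_term (post (arity R) a ∘ w).
  by rewrite /family_term ev_post !mcompA.
rewrite /family_term -uncurry2_transpose.
split=> [[v Hv]|[g Hg]].
  exists (untranspose v); apply: family_term_inj; apply: transpose_inj.
  rewrite /family_term -!uncurry2_transpose -Hv -post_transpose untransposeK.
  exact: mcompA.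
by exists (transpose g); rewrite -mcompA post_transpose Hg.
Qed.

End Structures.
End Base.

Theorem proposition5p8 (lam : regular_cardinal) (V : base lam) (L : language V)
    (HL : lambda_ary L) (A : structure L) (HA : vpresentable lam (A : Str L)) :
  exists (X : V) (pi : formula L X), presentation_formula A pi.
Proof.
pose cov R := constructive_indefinite_description _ (presentable_covers (rel_ob A R)).
pose I R : U := sval (cov R).
pose covY R := constructive_indefinite_description _ (proj2_sig (cov R)).
pose Y R : I R -> V := sval (covY R).
pose covy R := constructive_indefinite_description _ (proj2_sig (covY R)).
pose y R : forall i : I R, hom (Y R i) (rel_ob A R) := sval (covy R).
have HY R i : presentable lam (Y R i) by apply: (proj1 (proj2_sig (covy R))).
have Hy R : covers (y R) by apply: (proj2 (proj2_sig (covy R))).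
have [S HS] := few_instances_generate Hy HA.
pose phi (t : {t | S t}) : formula L (carrier A) :=
  f_rel (projT1 (sval t)) (Y _ (projT2 (sval t))) (family_term (inst y (projT2 (sval t)))).
have phiP (B : structure L) (h : hom A B) : is_morphism h <-> sat (f_and phi) h.
  apply: iff_trans (HS B h) _; apply: iff_sym; apply: iff_trans (sat_and _ _) _.
  split=> [H R i Ht|H [[R i] Ht]].
    exact: (proj1 (sat_rel _ _) (H (exist _ (existT _ R i) Ht))).
  by apply/sat_rel; exact: H.
have HX := carrier_presentable HL HA.
exists (carrier A), (f_and phi); split.
  split=> //; split=> //; split; first exact: subset_card.
  by move=> [t Ht]; split=> //; exact: HY.
exists (fun B h => exist _ (mor h) (proj1 (phiP B h) (morP h))); split=> // B.
exists (fun a => Morphism (proj2 (phiP B (sval a)) (proj2_sig a))).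
  by move=> [h Hh]; congr Morphism; exact: proof_irrelevance.
by move=> a; apply: sval_inj.
Qed.
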